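(* Let $G$ be a compact metrizable Abelian group with normalized Haar measure $\mu$ and dual group $\widehat G$, and let $\{\Gamma_N\}$ be a sequence of finite (nonempty) subsets of $\widehat G$ such that $|(\eta\Gamma_N)\triangle\Gamma_N|/|\Gamma_N|\to0$ as $N\to\infty$ for every $\eta\in\widehat G$. Let $\sigma\in L^1(G,\mu)$ be non-negative, let $\mathcal K_N=\operatorname{span}\Gamma_N\subset L^2(G)$, and let $T_\sigma^N:\mathcal K_N\to\mathcal K_N$ be the Toeplitz operator $T_\sigma^Nf=P_N(\sigma f)$, where $P_N$ is the orthogonal projection onto $\mathcal K_N$. Then $$\lim_{N\to\infty}\frac1{|\Gamma_N|}\operatorname{Tr}\bigl(\log(T_\sigma^N)\bigr)=\int_G\log\sigma(x)\,d\mu(x),$$ where the equality is understood in the extended real sense. In particular, the right-hand side is allowed to equal $-\infty$.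
   Context: $\widehat G$ is the (discrete, multiplicatively written) group of continuous characters of $G$, regarded as elements of $L^2(G,\mu)$. Since $\sigma f$ need only lie in $L^1(G)$, $P_N$ is understood on $L^1(G)$ by $P_Nh=\sum_{\xi\in\Gamma_N}\left(\int_Gh\overline\xi\,d\mu\right)\xi$. $\operatorname{Tr}(\log T_\sigma^N)=\sum_j\log\lambda_j$, the sum over the eigenvalues of the positive semidefinite operator $T_\sigma^N$ with multiplicity, with the convention $\log0=-\infty$ (so it equals $\log\det T_\sigma^N$); likewise $\log\sigma(x)=-\infty$ where $\sigma(x)=0$. *)

(* Defs.v *)
From HB Require Import structures.
From mathcomp Require Import all_boot all_order all_algebra.
From mathcomp Require Import all_classical all_reals all_analysis.
From mathcomp Require Import finmap complex.

Set Implicit Arguments.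
Unset Strict Implicit.
Unset Printing Implicit Defensive.

Import Order.TTheory GRing.Theory Num.Theory.
Import numFieldNormedType.Exports.

Local Open Scope classical_set_scope.
Local Open Scope fset_scope.
Local Open Scope ring_scope.
Local Open Scope complex_scope.

Definition metrizable (R : realType) (T : topologicalType) : Prop :=
  exists d : T -> T -> R,
    [/\ forall x y, d x y = 0 <-> x = y,
        forall x y, d x y = d y x,
        forall x y z, d x z <= d x y + d y z &
        forall x, nbhs x = nbhs_ball_ (fun a e => [set b | d a b < e]) x].

(* The ascription to zmodType supplies the point that measurableType needs. *)
Definition borel (G : topologicalZmodType) :=
  g_sigma_algebraType (@open G : set (set (G : zmodType))).

HB.instance Definition _ (G : topologicalZmodType) := Measurable.on (borel G).

Definition haar_invariant (R : realType) (G : topologicalZmodType)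
    (mu : probability (borel G) R) : Prop :=
  forall (a : G) (A : set (borel G)), measurable A ->
    mu [set (a + x : G) | x in A] = mu A.

(* [R[i]^o] carries the usual topology of the complex numbers. *)
Record dual (R : realType) (G : topologicalZmodType) := Dual {
  dual_fun :> G -> R[i];
  dual_continuous : continuous (dual_fun : G -> R[i]^o);
  dualD : forall x y, dual_fun (x + y) = dual_fun x * dual_fun y;
  dual_norm : forall x, `|dual_fun x| = 1 }.

Section DualGroup.
Context (R : realType) (G : topologicalZmodType).
Implicit Types xi eta zeta : dual R G.

HB.instance Definition _ := gen_eqMixin (dual R G).
HB.instance Definition _ := gen_choiceMixin (dual R G).

Lemma dual_ext xi eta : (forall x, xi x = eta x) -> xi = eta.
Proof.
case: xi eta => f fc fD fn [g gc gD gn] /= /funext fg; subst g.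
by congr Dual; exact: Prop_irrelevance.
Qed.

Fact dual1_continuous : continuous ((fun=> 1) : G -> R[i]^o).
Proof. exact: cst_continuous. Qed.

Definition dual1 : dual R G :=
  @Dual R G (fun=> 1) dual1_continuous
    (fun _ _ => esym (mulr1 1)) (fun=> normr1 _).

Fact dualM_continuous xi eta :
  continuous ((fun x => xi x * eta x) : G -> R[i]^o).
Proof.
move=> x; apply: (@cvgM R[i] G (nbhs x) _ (xi : G -> R[i]^o)).
- exact: dual_continuous.
- exact: dual_continuous.
Qed.

Fact dualMD xi eta x y :
  xi (x + y) * eta (x + y) = xi x * eta x * (xi y * eta y).
Proof. by rewrite !dualD mulrACA. Qed.

Fact dualM_norm xi eta x : `|xi x * eta x| = 1.
Proof. by rewrite normrM !dual_norm mulr1. Qed.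

Definition dualM xi eta : dual R G :=
  Dual (@dualM_continuous xi eta) (dualMD xi eta) (dualM_norm xi eta).

Fact dualV_continuous xi : continuous ((fun x => (xi x)^-1) : G -> R[i]^o).
Proof.
move=> x; apply: (@cvgV R[i] G (nbhs x) _ (xi : G -> R[i]^o)).
- by rewrite -normr_eq0 dual_norm oner_eq0.
- exact: dual_continuous.
Qed.

Fact dualVD xi x y : (xi (x + y))^-1 = (xi x)^-1 * (xi y)^-1.
Proof. by rewrite dualD invfM. Qed.

Fact dualV_norm xi x : `|(xi x)^-1| = 1.
Proof. by rewrite normfV dual_norm invr1. Qed.

Definition dualV xi : dual R G :=
  Dual (@dualV_continuous xi) (dualVD xi) (dualV_norm xi).

Fact dual_mulA : associative dualM.
Proof. by move=> *; apply: dual_ext => x; exact: mulrA. Qed.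
Fact dual_mul1 : left_id dual1 dualM.
Proof. by move=> *; apply: dual_ext => x; exact: mul1r. Qed.
Fact dual_mulr1 : right_id dual1 dualM.
Proof. by move=> *; apply: dual_ext => x; exact: mulr1. Qed.
Fact dual_mulV : left_inverse dual1 dualV dualM.
Proof.
move=> xi; apply: dual_ext => x; apply: mulVf.
by rewrite -normr_eq0 dual_norm oner_eq0.
Qed.
Fact dual_mulrV : right_inverse dual1 dualV dualM.
Proof.
move=> xi; apply: dual_ext => x; apply: mulfV.
by rewrite -normr_eq0 dual_norm oner_eq0.
Qed.

HB.instance Definition _ := isGroup.Build (dual R G)
  dual_mulA dual_mul1 dual_mulr1 dual_mulV dual_mulrV.

End DualGroup.

Section Span.
Context (R : realType) (G : topologicalZmodType) (Gam : {fset dual R G}).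

Definition char_comb (c : dual R G -> R[i]) : G -> R[i] :=
  \sum_(xi <- Gam) c xi *: (xi : G -> R[i]).

Definition char_span : {pred G -> R[i]} :=
  fun f => `[< exists c, f = char_comb c >].

Fact char_span_submod : submod_closed char_span.
Proof.
split=> [|a f g /asboolP[c ->] /asboolP[c' ->]]; apply/asboolP.
  by exists (fun=> 0); rewrite /char_comb big1// => xi _; rewrite scale0r.
exists (fun xi => a * c xi + c' xi).
rewrite /char_comb scaler_sumr -big_split; apply: eq_bigr => xi _ /=.
by rewrite scalerDl scalerA.
Qed.
HB.instance Definition _ :=
  GRing.isSubmodClosed.Build R[i] (G -> R[i]) char_span char_span_submod.

Record kspace := KSpace { kval :> G -> R[i]; _ : kval \in char_span }.
HB.instance Definition _ := [isSub for kval].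
HB.instance Definition _ := [Choice of kspace by <:].
HB.instance Definition _ := [SubChoice_isSubLmodule of kspace by <:].

End Span.

Section Dimension.
Context (R : realType) (G : topologicalZmodType).

Lemma char_combE (Gam : {fset dual R G}) c x :
  char_comb Gam c x = \sum_(xi <- Gam) c xi * xi x.
Proof. by rewrite /char_comb fct_sumE. Qed.

Lemma dual_free (s : seq (dual R G)) (c : dual R G -> R[i]) : uniq s ->
  (forall x, \sum_(xi <- s) c xi * xi x = 0) -> {in s, forall xi, c xi = 0}.
Proof.
elim: s c => [//|xi s IHs] c /= /andP[xis us] c0.
have cs zeta : zeta \in s -> c zeta = 0.
  move=> zs; have [y /eqP yP] : exists y, zeta y <> xi y.
    by apply/existsNP => h; move: xis; rewrite -(dual_ext h) zs.
  suff /(IHs (fun eta => c eta * (eta y - xi y)) us)/(_ zeta zs)/eqP :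
      forall x, \sum_(eta <- s) c eta * (eta y - xi y) * eta x = 0.
    by rewrite mulf_eq0 subr_eq0 (negbTE yP) orbF => /eqP.
  move=> x.
  have := c0 (y + x); have := congr1 ( *%R (xi y)) (c0 x).
  rewrite !big_cons mulr0 mulrDr => e1 e2.
  have {e1 e2} := congr2 (fun a b => a - b) e2 e1.
  rewrite subr0 dualD mulrCA opprD addrACA subrr add0r mulr_sumr -sumrB => e.
  rewrite -[RHS]e; apply: eq_bigr => eta _; rewrite dualD.
  by rewrite mulrBr mulrBl !mulrA [xi y * c eta]mulrC.
move=> eta; rewrite inE => /orP[/eqP->|/cs//].
have := c0 0; rewrite big_cons big_seq big1 ?addr0; last first.
  by move=> zeta zs; rewrite cs// mul0r.
move/eqP; rewrite mulf_eq0 => /orP[/eqP//|/eqP xi0].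
by have := dual_norm xi 0; rewrite xi0 normr0 => /esym/eqP; rewrite oner_eq0.
Qed.

Context (Gam : {fset dual R G}).

Fact char_comb_in c : char_comb Gam c \in char_span Gam.
Proof. by apply/asboolP; exists c. Qed.

Definition comb c : kspace Gam := KSpace (char_comb_in c).

Definition span_coef (f : kspace Gam) : dual R G -> R[i] :=
  sval (cid (asboolP _ (valP f))).

Lemma span_coefE (f : kspace Gam) : kval f = char_comb Gam (span_coef f).
Proof. exact: svalP (cid (asboolP _ (valP f))). Qed.

Lemma char_comb_inj c c' : char_comb Gam c = char_comb Gam c' ->
  {in Gam, c =1 c'}.
Proof.
move=> cc' xi xiG; apply/eqP; rewrite -subr_eq0; apply/eqP.
apply: (@dual_free Gam (fun xi => c xi - c' xi) (fset_uniq Gam)) => // x.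
under eq_bigr do rewrite mulrBl.
by rewrite sumrB -!char_combE cc' subrr.
Qed.

Fact kspace_vect : Vector.axiom #|` Gam| (kspace Gam).
Proof.
pose v2r (f : kspace Gam) : 'rV[R[i]]_(#|` Gam|) :=
  \row_i span_coef f (tnth (in_tuple Gam) i).
have inG i : tnth (in_tuple Gam) i \in Gam by exact: mem_tnth.
exists v2r.
  move=> a f g; apply/rowP => i; rewrite !mxE.
  pose c xi := a * span_coef f xi + span_coef g xi.
  rewrite -[RHS]/(c _); apply: char_comb_inj => //; rewrite -span_coefE.
  rewrite -[LHS]/(a *: kval f + kval g) !span_coefE /char_comb scaler_sumr.
  rewrite -big_split; apply: eq_bigr => xi _ /=.
  by rewrite scalerA -scalerDl.
pose c (u : 'rV[R[i]]_(#|` Gam|)) xi : R[i] :=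
  odflt 0 (omap (u 0) (insub (index xi Gam))).
have cE u i : c u (tnth (in_tuple Gam) i) = u 0 i.
  rewrite /c (tnth_nth (tnth (in_tuple Gam) i)) index_uniq// ?fset_uniq//.
  by rewrite valK.
exists (fun u => comb (c u)) => [f|u].
  apply: val_inj; rewrite /= [RHS]span_coefE /char_comb.
  rewrite [LHS]big_tnth [RHS]big_tnth.
  by apply: eq_bigr => i _; rewrite cE mxE.
by apply/rowP => i; rewrite mxE -cE; apply: char_comb_inj => //;
  rewrite -span_coefE.
Qed.
HB.instance Definition _ :=
  Lmodule_hasFinDim.Build R[i] (kspace Gam) kspace_vect.

End Dimension.

Section Toeplitz.
Context (R : realType) (G : topologicalZmodType) (mu : probability (borel G) R).

Definition cintegral (f : G -> R[i]) : R[i] :=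
  (\int[mu]_x complex.Re (f x)) +i* (\int[mu]_x complex.Im (f x)).

(* The orthogonal projection onto the span of [Gam] extended to L^1, written *)
(* with the Fourier coefficients of [h].                                     *)
Definition char_proj (Gam : {fset dual R G}) (h : G -> R[i]) : kspace Gam :=
  comb Gam (fun xi => cintegral (fun x => h x * (xi x)^*)).

(* [linfun] yields the intended operator when its argument is linear, which *)
(* holds for integrable [sigma]: see [toeplitzE] below.                     *)
Definition toeplitz (Gam : {fset dual R G}) (sigma : G -> R) :
    'End(kspace Gam) :=
  linfun (fun f : kspace Gam => char_proj Gam (fun x => (sigma x)%:C * f x)).

End Toeplitz.

Section ToeplitzTheory.
Context (R : realType) (G : topologicalZmodType) (mu : probability (borel G) R).

Definition cintegrable (f : G -> R[i]) :=
  mu.-integrable setT (fun x : borel G => (complex.Re (f x))%:E) /\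
  mu.-integrable setT (fun x : borel G => (complex.Im (f x))%:E).

Lemma complexReM (a b : R[i]) : complex.Re (a * b) =
  complex.Re a * complex.Re b - complex.Im a * complex.Im b.
Proof. by case: a b => ? ? []. Qed.
Lemma complexImM (a b : R[i]) : complex.Im (a * b) =
  complex.Re a * complex.Im b + complex.Im a * complex.Re b.
Proof. by case: a b => ? ? []. Qed.
Lemma complexReD (a b : R[i]) :
  complex.Re (a + b) = complex.Re a + complex.Re b.
Proof. by case: a b => ? ? []. Qed.
Lemma complexImD (a b : R[i]) :
  complex.Im (a + b) = complex.Im a + complex.Im b.
Proof. by case: a b => ? ? []. Qed.

Lemma cintZ a f : cintegrable f ->
  cintegrable (fun x => a * f x) /\
  cintegral mu (fun x => a * f x) = a * cintegral mu f.
Proof.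
move=> [fr fi].
have I r g : mu.-integrable setT (EFin \o g) ->
    mu.-integrable setT (EFin \o (fun x : borel G => r * g x)).
  by move=> ig; apply: (integrableZl measurableT _ ig).
split.
  split; under [X in _.-integrable _ X]funext
      do rewrite ?complexReM ?complexImM ?EFinB ?EFinD.
    by apply: (integrableB measurableT (I _ _ fr) (I _ _ fi)).
  by apply: (integrableD measurableT (I _ _ fi) (I _ _ fr)).
rewrite /cintegral; apply/eqP; rewrite eq_complex; apply/andP; split; apply/eqP.
- rewrite complexReM /= -!RintegralZl// -RintegralB//; try exact: I.
  by apply: eq_Rintegral => x _; rewrite complexReM.
- rewrite complexImM /= -!RintegralZl// -RintegralD//; try exact: I.
  by apply: eq_Rintegral => x _; rewrite complexImM.
Qed.

Lemma cintD f g : cintegrable f -> cintegrable g ->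
  cintegrable (fun x => f x + g x) /\
  cintegral mu (fun x => f x + g x) = cintegral mu f + cintegral mu g.
Proof.
move=> [fr fi] [gr gi]; split.
  split; under [X in _.-integrable _ X]funext
      do rewrite ?complexReD ?complexImD ?EFinD.
    by apply: (integrableD measurableT fr gr).
  by apply: (integrableD measurableT fi gi).
rewrite /cintegral; apply/eqP; rewrite eq_complex; apply/andP; split; apply/eqP.
- rewrite complexReD /= -RintegralD//.
  by apply: eq_Rintegral => x _; rewrite complexReD.
- rewrite complexImD /= -RintegralD//.
  by apply: eq_Rintegral => x _; rewrite complexImD.
Qed.

Lemma continuous_borel_measurable (g : G -> R) :
  continuous g -> measurable_fun setT (g : borel G -> R).
Proof.
move=> cg; apply: measurability.
  exact: measurable_realfun.RGenOInfty.measurableE.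
move=> _ [_ [a ->] <-]; rewrite setTI; apply: sub_sigma_algebra.
by apply: open_comp; [move=> x _; exact: cg | exact: interval_open].
Qed.

Lemma norm_complex_part (z : R[i]) :
  `|(complex.Re z)%:C| <= `|z| /\ `|(complex.Im z)%:C| <= `|z|.
Proof.
case: z => a b; rewrite !normc_def /= !lecR !expr0n /= !addr0.
by split; apply: ler_wsqrtr; rewrite ?lerDl ?lerDr sqr_ge0.
Qed.

Lemma norm_real_complex (a : R) : `|a%:C| = `|a|%:C.
Proof. by rewrite normc_def /= expr0n /= addr0 sqrtr_sqr. Qed.

Lemma dual_ReIm (xi : dual R G) :
  [/\ continuous (fun x => complex.Re (xi x)),
      continuous (fun x => complex.Im (xi x)),
      forall x, `|complex.Re (xi x)| <= 1 &
      forall x, `|complex.Im (xi x)| <= 1].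
Proof.
split.
- move=> x; apply/cvgrPdist_lt => e e0.
  have e0' : 0 < e%:C by rewrite ltcR.
  have /cvgrPdist_lt/(_ _ e0') := @dual_continuous _ _ xi x.
  apply: filterS => y; rewrite -ltcR -norm_real_complex; apply: le_lt_trans.
  have := (norm_complex_part (xi x - xi y)).1.
  by case: (xi x) (xi y) => ? ? [].
- move=> x; apply/cvgrPdist_lt => e e0.
  have e0' : 0 < e%:C by rewrite ltcR.
  have /cvgrPdist_lt/(_ _ e0') := @dual_continuous _ _ xi x.
  apply: filterS => y; rewrite -ltcR -norm_real_complex; apply: le_lt_trans.
  have := (norm_complex_part (xi x - xi y)).2.
  by case: (xi x) (xi y) => ? ? [].
- by move=> x; have := (norm_complex_part (xi x)).1;
  rewrite dual_norm norm_real_complex lecR.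
- by move=> x; have := (norm_complex_part (xi x)).2;
  rewrite dual_norm norm_real_complex lecR.
Qed.

Lemma cint_dual (sigma : G -> R) (xi : dual R G) :
  mu.-integrable setT (EFin \o (sigma : borel G -> R)) ->
  cintegrable (fun x => (sigma x)%:C * xi x).
Proof.
move=> si; have [c1 c2 b1 b2] := dual_ReIm xi.
have H (h : borel G -> R) : measurable_fun setT h -> (forall x, `|h x| <= 1) ->
  mu.-integrable setT (fun x : borel G => (sigma x * h x)%:E).
  move=> mh bh; apply: (integrableMl measurableT si mh).
  by exists 1; split => // M M1 x _ /=; rewrite (le_trans (bh x))// ltW.
split; under [X in _.-integrable _ X]funext
    do rewrite ?complexReM ?complexImM /= mul0r ?subr0 ?addr0.
  exact: H (continuous_borel_measurable c1) b1.
exact: H (continuous_borel_measurable c2) b2.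
Qed.

Lemma cint0 : cintegrable (fun=> 0).
Proof. by split; exact: integrable0. Qed.

Lemma dual_conj (xi : dual R G) x : ((xi x)^*)%R = (xi^-1)%g x.
Proof.
have xi0 : xi x != 0 by rewrite -normr_eq0 dual_norm oner_eq0.
apply: (mulfI xi0); rewrite [in RHS](mulfV xi0).
by rewrite -normCK dual_norm expr1n.
Qed.

Lemma cint_span (sigma : G -> R) Gam (f : kspace Gam) (xi : dual R G) :
  mu.-integrable setT (EFin \o (sigma : borel G -> R)) ->
  cintegrable (fun x => (sigma x)%:C * f x * (xi x)^*).
Proof.
move=> si; have -> : (fun x => (sigma x)%:C * f x * (xi x)^*) =
    (fun x => \sum_(zeta <- Gam) span_coef f zeta *
       ((sigma x)%:C * (zeta * xi^-1)%g x)).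
  apply/funext => x; rewrite span_coefE char_combE mulr_sumr mulr_suml.
  apply: eq_bigr => zeta _; rewrite dual_conj.
  rewrite -[(zeta * _)%g x]/(zeta x * (xi^-1)%g x).
  by rewrite mulrCA !mulrA.
elim: (enum_fset Gam) => [|zeta s IHs].
  by under eq_fun do rewrite big_nil; exact: cint0.
under eq_fun do rewrite big_cons.
by apply: (cintD _ IHs).1; apply: (cintZ _ _).1; exact: cint_dual.
Qed.

Lemma toeplitzE (sigma : G -> R) Gam (f : kspace Gam) :
  mu.-integrable setT (EFin \o (sigma : borel G -> R)) ->
  toeplitz mu Gam sigma f = char_proj mu Gam (fun x => (sigma x)%:C * f x).
Proof.
move=> si.
pose T (f : kspace Gam) := char_proj mu Gam (fun x => (sigma x)%:C * f x).
have Tlin : linear T.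
  move=> a g h; apply: val_inj.
  rewrite -[RHS]/(a *: char_comb Gam _ + char_comb Gam _).
  rewrite /T /= /char_comb scaler_sumr -big_split; apply: eq_bigr => xi _ /=.
  have [ig _] := cintZ a (cint_span g xi si).
  have [_ eD] := cintD ig (cint_span h xi si).
  rewrite scalerA -scalerDl -(cintZ a (cint_span g xi si)).2 -eD.
  congr (cintegral _ _ *: _); apply/funext => x /=.
  rewrite -[LHS]/((sigma x)%:C * (a * g x + h x) * ((xi x)^*)%R).
  by rewrite mulrDr mulrDl mulrCA !mulrA.
pose TL : {linear kspace Gam -> kspace Gam} :=
  HB.pack T (GRing.isLinear.Build _ _ _ _ T Tlin).
exact: (lfunE TL).
Qed.

End ToeplitzTheory.

(* Meant for positive semidefinite operators: the eigenvalues are then real   *)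
(* and nonnegative, and the multiplicity of an eigenvalue is the dimension of *)
(* its eigenspace. Note that [lne 0 = -oo].                                   *)
Definition tr_log (R : realType) (V : vectType R[i]) (T : 'End(V)) : \bar R :=
  (\sum_(lam \in [set lam | passmx.leigenvalue T lam])
     (\dim (passmx.leigenspace T lam))%:R%:E * lne (complex.Re lam)%:E)%E.

(* Main.v *)
(** Lower bound, for every N. Let e_j be an orthonormal eigenbasis of the Toeplitz matrix, with
    eigenvalues l_j. Each |e_j|^2 is a probability density and the |e_j|^2 add up to the constant
    |Gamma|, so Jensen's inequality for l_j = int sigma |e_j|^2 gives, for every eps > 0,
      (1/|Gamma|) sum_j ln (l_j + eps) >= int ln (sigma + eps).

    Upper bound. The tangent inequality
      ln l_j <= ln (sigma + eps) + l_j / (sigma + eps) - 1,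
    integrated against |e_j|^2, reduces it to (1/|Gamma|) sum_j l_j |e_j|^2 -> sigma in L^1. This
    mean is the convolution of sigma with the Fejer kernel F = |sum_(xi in Gamma) xi|^2 / |Gamma|,
    whose coefficients |Gamma /\ chi Gamma| / |Gamma| tend to 1 by the Folner condition. Hence
    int F (1 - Re chi) -> 0 for each character chi, and F concentrates at 0 because characters
    separate points. Finally eps -> 0 by monotone convergence.

    Characters separate points. For a real even continuous q <> 0 the normalized convolution powers
    of q ** q converge to a nonzero convolution idempotent, and a minimal idempotent below it is, up
    to a factor, a function C with C(x + y) + C(x - y) = 2 C(x) C(y). Kannappan's argument writes C
    as the real part of a character. *)

From HB Require Import structures.
Require Import Defs.
From mathcomp Require Import all_boot all_order all_algebra.
From mathcomp Require Import all_classical all_reals all_analysis.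
From mathcomp Require Import finmap complex measurable_realfun spectral.
From mathcomp Require Import ring lra zify.

Set Implicit Arguments.
Unset Strict Implicit.
Unset Printing Implicit Defensive.

Import Order.TTheory GRing.Theory Num.Theory.
Import numFieldNormedType.Exports.

Local Open Scope classical_set_scope.
Local Open Scope ring_scope.

(** * Integration over a compact group *)

(** Complex integrals are defined here through real and imaginary parts, so the harmonic analysis is
    carried out with real even functions. There a minimal idempotent is not a character but a
    multiple of some [Re chi], which is why a cosine equation appears. The function that starts the
    power iteration must see the point [x0] to be separated from 0: it is a symmetric second
    difference in the direction [x0], so convolution with it kills every even [p] whose two
    translates by [x0] and [- x0] add up to [2 p].

    Since [sigma] is only integrable and may vanish, [ln sigma] may fail to be integrable and the
    Toeplitz operator may be singular. The shift by eps keeps every integral real. In the lower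
    bound it acts on the symbol and on the eigenvalues, and it is removed for each N separately,
    where only finitely many eigenvalues occur. In the upper bound it acts on the symbol alone, and
    a zero eigenvalue makes the left side [-oo]. The L^1 error enters there with the factor 1/eps,
    so N has to tend to infinity while eps is fixed. *)

Section RealIntegrable.
Context d (T : measurableType d) (R : realType) (mu : {measure set T -> \bar R}).
Implicit Types f g : T -> R.

Lemma integrable_addR f g : mu.-integrable setT (fun x => (f x)%:E) ->
  mu.-integrable setT (fun x => (g x)%:E) ->
  mu.-integrable setT (fun x => (f x + g x)%:E).
Proof. by move=> fi gi; exact: (integrableD measurableT fi gi). Qed.

Lemma integrable_subR f g : mu.-integrable setT (fun x => (f x)%:E) ->
  mu.-integrable setT (fun x => (g x)%:E) ->
  mu.-integrable setT (fun x => (f x - g x)%:E).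
Proof. by move=> fi gi; exact: (integrableB measurableT fi gi). Qed.

Lemma integrable_mulR c f : mu.-integrable setT (fun x => (f x)%:E) ->
  mu.-integrable setT (fun x => (c * f x)%:E).
Proof. by move=> fi; exact: (integrableZl measurableT c fi). Qed.

Lemma integrable_normR f : mu.-integrable setT (fun x => (f x)%:E) ->
  mu.-integrable setT (fun x => `|f x|%:E).
Proof. by move=> fi; exact: (integrable_norm fi). Qed.

Lemma le_RintegralT f g : mu.-integrable setT (fun x => (f x)%:E) ->
  mu.-integrable setT (fun x => (g x)%:E) -> (forall x, f x <= g x) ->
  \int[mu]_x f x <= \int[mu]_x g x.
Proof. by move=> fi gi fg; exact: (le_Rintegral measurableT fi gi). Qed.

Lemma integrable_sumR I (r : seq I) (F : I -> T -> R) :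
  (forall i, mu.-integrable setT (fun x => (F i x)%:E)) ->
  mu.-integrable setT (fun x => (\sum_(i <- r) F i x)%:E).
Proof.
move=> Fi; elim: r => [|i r IHr].
  by under eq_fun do rewrite big_nil; exact: integrable0.
by under eq_fun do rewrite big_cons; exact: integrable_addR.
Qed.

Lemma Rintegral_sum I (r : seq I) (F : I -> T -> R) :
  (forall i, mu.-integrable setT (fun x => (F i x)%:E)) ->
  \int[mu]_x (\sum_(i <- r) F i x) = \sum_(i <- r) \int[mu]_x F i x.
Proof.
move=> Fi; elim: r => [|i r IHr].
  under eq_Rintegral do rewrite big_nil.
  by rewrite /Rintegral integral0 big_nil.
under eq_Rintegral do rewrite big_cons.
by rewrite (RintegralD measurableT (Fi i) (integrable_sumR r Fi)) big_cons IHr.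
Qed.

End RealIntegrable.

Lemma Rintegral_prob_cst d (T : measurableType d) (R : realType)
  (P : probability T R) (c : R) : \int[P]_x c = c.
Proof. by rewrite /Rintegral integral_cst//= probability_setT mule1. Qed.

(** [compact_cover] takes a pointed space; [0] serves as the point. *)
Lemma compact_cover_zmod (G : topologicalZmodType) (A : set G) :
  compact A -> cover_compact A.
Proof.
pose pT := HB.pack_for ptopologicalType (G : Type) (Topological.on G)
  (isPointed.Build (G : Type) (0 : G)).
by rewrite -(@compact_cover pT).
Qed.

Lemma countable_bigcup_measurable d (T : measurableType d) I (D : set I)
  (F : I -> set T) : countable D -> (forall i, D i -> measurable (F i)) ->
  measurable (\bigcup_(i in D) F i).
Proof.
move=> /pfcard_geP[->|[f]] mF; first by rewrite bigcup_set0.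
rewrite -(image_eq f) bigcup_image; apply: bigcup_measurable => n _.
by apply: mF; exact: funS.
Qed.

Section CompactGroup.
Context (R : realType) (G : topologicalZmodType) (mu : probability (borel G) R).
Hypothesis Gcompact : compact [set: G].

Lemma continuous_bounded (f : G -> R) : continuous f ->
  exists2 M, 0 <= M & forall x, `|f x| <= M.
Proof.
move=> cf.
have /compact_bounded[M [_ hM]] : compact (f @` [set: G]).
  by apply: continuous_compact => //; exact: continuous_subspaceT.
exists (`|M| + 1); first by rewrite addr_ge0.
move=> x; apply: hM; last by exists x.
by rewrite (le_lt_trans (ler_norm M))// ltrDl.
Qed.

Lemma continuous_integrable (f : G -> R) : continuous f ->
  mu.-integrable setT (fun x : borel G => (f x)%:E).
Proof.
move=> cf; have [M M0 hM] := continuous_bounded cf.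
apply: measurable_bounded_integrable => //.
- by rewrite (le_lt_trans (probability_le1 _ _))// ltry.
- exact: continuous_borel_measurable.
- by exists M; split; [exact: num_real|move=> N MN x _ /=; apply: le_trans (hM x) (ltW MN)].
Qed.

(* Near-covering compactness makes the modulus of continuity uniform in the second variable. *)
Lemma continuous_integral (h : G * G -> R) : continuous h ->
  continuous (fun x => \int[mu]_y h (x, y)).
Proof.
move=> ch x; apply/cvgrPdist_le => e e0.
have : \forall x' \near x, [set: G] `<=` [set y | `|h (x, y) - h (x', y)| <= e].
  move/compact_near_coveringP : Gcompact; apply => y _.
  have /cvgrPdist_lt/(_ (e / 2)) := ch (x, y).
  rewrite divr_gt0// => /(_ isT) [[U V] /= [nU nV] UV].
  exists (V, U) => //= -[y' x'] /= [Vy' Ux'].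
  have h1 := UV (x', y') (conj Ux' Vy').
  have h2 := UV (x, y') (conj (nbhs_singleton nU) Vy').
  rewrite /= in h1 h2.
  rewrite -(subrKA (h (x, y))) (le_trans (ler_normD _ _))//.
  by rewrite distrC; lra.
apply: filterS => x' hx'.
have c1 x0 : mu.-integrable setT (fun y : borel G => (h (x0, y))%:E).
  apply: continuous_integrable => y; apply: continuous_comp; last exact: ch.
  by apply: cvg_pair => //=; exact: cvg_cst.
rewrite -RintegralB//; try exact: c1.
apply: le_trans (le_normr_Rintegral _ _) _ => //.
  by apply: integrable_subR; exact: c1.
rewrite -(Rintegral_prob_cst mu e).
apply: le_RintegralT.
- by apply: integrable_normR; apply: integrable_subR; exact: c1.
- exact: finite_measure_integrable_cst.
- by move=> y; exact: (hx' y I).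
Qed.

Hypothesis Gmetrizable : metrizable R G.

(** For each [n], finitely many balls of radius [1/(n+1)] cover the group; all of them together form
    the basis. A ball of radius below [e/2] that contains [x] lies in the [e]-ball around [x]. *)
Lemma metrizable_second_countable : @second_countable G.
Proof.
have [d [d0 dC dT dnbhs]] := Gmetrizable.
pose f n (z : G) : set G := [set b | d z b < n.+1%:R^-1]°.
have h n : finite_subset_cover [set: G] (f n) [set: G].
  apply: (compact_cover_zmod Gcompact).
  - by move=> z _; exact: open_interior.
  - move=> z _; exists z => //; rewrite /f /interior/= dnbhs.
    by exists n.+1%:R^-1 => //=.
pose h' n := cid (iffLR (exists2P _ _) (h n)).
pose h'' n := projT1 (h' n).
pose B := \bigcup_n (f n) @` [set` h'' n]; exists B; [|split].
- apply: bigcup_countable => // n _; apply: finite_set_countable.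
  exact/finite_image/finite_fset.
- by move => ? [? _ [? _ <-]]; exact: open_interior.
- move=> x V nV; have {nV} : nbhs x V by []; rewrite dnbhs => -[e/= e0 eV].
  have [//|N] := @ltr_add_invr R 0%R (e/2) _; first by rewrite divr_gt0.
  rewrite add0r => deleps.
  have [w wh fx] : exists2 w : G, w \in h'' N & f N w x.
    by have [_ /(_ x) [// | w ? ?]] := projT2 (h' N); exists w.
  exists (f N w); first split => //; first (by exists N).
  move=> z /interior_subset/= bz; apply: eV => /=.
  move/interior_subset : fx => /=; rewrite dC => fx.
  apply: (le_lt_trans (dT _ w _)).
  by move: (N.+1%:R^-1 : R) deleps bz fx => c *; lra.
Qed.

(** The sigma-algebra on the product is generated by measurable rectangles. Second countability
    writes an open subset of [G * G] as a countable union of open rectangles, which makes Fubini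
    available for continuous functions. *)
Lemma continuous_prod_measurable (h : G * G -> R) : continuous h ->
  measurable_fun setT (h : borel G * borel G -> R).
Proof.
move=> ch; apply: measurability.
  exact: measurable_realfun.RGenOInfty.measurableE.
move=> _ [_ [a ->] <-]; rewrite setTI.
set O := _ @^-1` _.
have oO : open O by apply: open_comp; [move=> x _; exact: ch | exact: interval_open].
have [B cB [Bo Bb]] := metrizable_second_countable.
pose C := [set UV : set G * set G | [/\ B UV.1, B UV.2 & UV.1 `*` UV.2 `<=` O]].
have -> : O = \bigcup_(UV in C) (UV.1 `*` UV.2).
  apply/seteqP; split => [[x y] Oxy|xy [UV [_ _ UVO]] /UVO//].
  have /oO[[U V] /= [nU nV] UVO] := Oxy.
  have [U' [BU' U'x] U'U] := Bb _ _ nU.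
  have [V' [BV' V'x] V'V] := Bb _ _ nV.
  exists (U', V') => //; split => //= z [zU zV]; apply: UVO; split.
    exact: U'U.
  exact: V'V.
apply: countable_bigcup_measurable.
- have : countable (B `*` B) by exact: countableX.
  by apply: sub_countable; apply: subset_card_le => -[U V] [].
- move=> [U V] [/Bo oU /Bo oV _]; apply: measurableX; exact: sub_sigma_algebra.
Qed.

Lemma continuous_prod_integrable (h : G * G -> R) : continuous h ->
  (mu \x mu)%E.-integrable setT (fun z : borel G * borel G => (h z)%:E).
Proof.
move=> ch.
have [M hM] : exists M, forall z, `|h z| <= M.
  have : compact ([set: G] `*` [set: G]) by exact: compact_setX.
  rewrite setXTT => cG2.
  have /compact_bounded[M [_ hM]] : compact (h @` setT).
    by apply: continuous_compact => //; exact: continuous_subspaceT.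
  exists (`|M| + 1) => z; apply: hM; last by exists z.
  by rewrite (le_lt_trans (ler_norm M))// ltrDl.
apply: measurable_bounded_integrable => //.
- exact: (le_lt_trans (probability_le1 (mu \x mu)%E measurableT) (ltry _)).
- exact: continuous_prod_measurable.
- by exists M; split; [exact: num_real|move=> N MN x _ /=; apply: le_trans (hM x) (ltW MN)].
Qed.

Lemma Rintegral_swap (h : G * G -> R) : continuous h ->
  \int[mu]_x \int[mu]_y h (x, y) = \int[mu]_y \int[mu]_x h (x, y).
Proof.
move=> ch; rewrite /Rintegral.
have c1 (k : G * G -> R) : continuous k ->
    (fun x : borel G => (fine (\int[mu]_y (k (x, y))%:E)%E)%:E)
    = (fun x => \int[mu]_y (k (x, y))%:E)%E.
  move=> ck; apply/funext => x; rewrite fineK//.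
  apply: integrable_fin_num => //; apply: continuous_integrable => y.
  apply: continuous_comp; last exact: ck.
  by apply: cvg_pair => //=; exact: cvg_cst.
rewrite c1// (c1 (fun z => h (z.2, z.1))).
  by rewrite (Fubini (continuous_prod_integrable ch)).
move=> z; apply: continuous_comp; last exact: ch.
by apply: cvg_pair; [exact: cvg_snd|exact: cvg_fst].
Qed.

End CompactGroup.

Section ContinuousFunctions.
Context (R : realType) (T U : topologicalType).
Implicit Types f g : T -> R.

Lemma contD f g : continuous f -> continuous g -> continuous (fun x => f x + g x).
Proof. by move=> cf cg x; apply: cvgD; [exact: cf|exact: cg]. Qed.

Lemma contB f g : continuous f -> continuous g -> continuous (fun x => f x - g x).
Proof. by move=> cf cg x; apply: cvgB; [exact: cf|exact: cg]. Qed.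

Lemma contM f g : continuous f -> continuous g -> continuous (fun x => f x * g x).
Proof. by move=> cf cg x; apply: cvgM; [exact: cf|exact: cg]. Qed.

Lemma contZ c f : continuous f -> continuous (fun x => c * f x).
Proof. by move=> cf; apply: contM => // x; exact: cvg_cst. Qed.

Lemma cont_comp (V : topologicalType) (h : U -> V) (k : T -> U) :
  continuous h -> continuous k -> continuous (fun x => h (k x)).
Proof. by move=> ch ck x; apply: continuous_comp; [exact: ck|exact: ch]. Qed.

Lemma cont_pair (V : topologicalType) (h : T -> U) (k : T -> V) :
  continuous h -> continuous k -> continuous (fun x => (h x, k x)).
Proof. by move=> ch ck x; apply: cvg_pair; [exact: ch|exact: ck]. Qed.

End ContinuousFunctions.

Section ContinuousGroup.
Context (T : topologicalType) (G : topologicalZmodType).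
Implicit Types f g : T -> G.

Lemma cont_addG f g : continuous f -> continuous g -> continuous (fun x => f x + g x).
Proof.
move=> cf cg; apply: (@cont_comp _ _ _ (fun z : G * G => z.1 + z.2) (fun x => (f x, g x))).
  exact: add_continuous.
exact: cont_pair.
Qed.

Lemma cont_oppG f : continuous f -> continuous (fun x => - f x).
Proof. by move=> cf; apply: cont_comp cf => //; exact: opp_continuous. Qed.

Lemma cont_subG f g : continuous f -> continuous g -> continuous (fun x => f x - g x).
Proof. by move=> cf cg; apply: cont_addG => //; exact: cont_oppG. Qed.

End ContinuousGroup.

Lemma cont_id (T : topologicalType) : continuous (fun x : T => x).
Proof. by move=> x; exact: cvg_id. Qed.

Lemma cont_fst (T U : topologicalType) : continuous (fun x : T * U => x.1).
Proof. by move=> x; exact: cvg_fst. Qed.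

Lemma cont_snd (T U : topologicalType) : continuous (fun x : T * U => x.2).
Proof. by move=> x; exact: cvg_snd. Qed.

Ltac cont := repeat (exact: cst_continuous || exact: cont_id || exact: cont_fst
  || exact: cont_snd || assumption || apply: cont_subG || apply: cont_addG || apply: cont_oppG
  || apply: contB || apply: contD || apply: contM).

Section HaarIntegral.
Context (R : realType) (G : topologicalZmodType) (mu : probability (borel G) R).
Hypothesis Gcompact : compact [set: G].
Hypothesis Gmetrizable : metrizable R G.
Hypothesis mu_invariant : haar_invariant mu.
Implicit Types (f g h : G -> R).

Definition haar_int f : R := \int[mu]_x f x.
Local Notation I := haar_int.

Lemma eq_haar_int f g : f =1 g -> I f = I g.
Proof. by move=> fg; apply: eq_Rintegral => x _; exact: fg. Qed.

Lemma haar_int_cst c : I (fun=> c) = c.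
Proof. exact: Rintegral_prob_cst. Qed.

Lemma haar_intD f g : continuous f -> continuous g ->
  I (fun x => f x + g x) = I f + I g.
Proof. by move=> cf cg; apply: RintegralD => //; exact: continuous_integrable. Qed.

Lemma haar_intB f g : continuous f -> continuous g ->
  I (fun x => f x - g x) = I f - I g.
Proof. by move=> cf cg; apply: RintegralB => //; exact: continuous_integrable. Qed.

Lemma haar_intZ c f : continuous f -> I (fun x => c * f x) = c * I f.
Proof. by move=> cf; apply: RintegralZl => //; exact: continuous_integrable. Qed.

Lemma le_haar_int f g : continuous f -> continuous g -> (forall x, f x <= g x) ->
  I f <= I g.
Proof.
move=> cf cg fg; apply: (@le_RintegralT _ (borel G) R mu f g) => [||x].
- exact: continuous_integrable.
- exact: continuous_integrable.
- exact: fg.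
Qed.

Lemma haar_int_ge0 f : (forall x, 0 <= f x) -> 0 <= I f.
Proof. by move=> f0; apply: Rintegral_ge0 => x _. Qed.

Lemma haar_int_sum J (r : seq J) (F : J -> G -> R) : (forall i, continuous (F i)) ->
  I (fun x => \sum_(i <- r) F i x) = \sum_(i <- r) I (F i).
Proof. by move=> cF; apply: Rintegral_sum => i; exact: continuous_integrable. Qed.

Lemma haar_int_norm f M : continuous f -> (forall x, `|f x| <= M) -> `|I f| <= M.
Proof.
move=> cf fM; rewrite -(haar_int_cst M) ler_norml.
rewrite -[X in X <= _](_ : I (fun=> - M) = _); last by rewrite !haar_int_cst.
by apply/andP; split; apply: le_haar_int => //; try exact: cst_continuous;
  move=> x; have := fM x; rewrite ler_norml => /andP[].
Qed.

Lemma continuous_haar_int (h : G * G -> R) : continuous h ->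
  continuous (fun x => I (fun y => h (x, y))).
Proof. exact: continuous_integral. Qed.

Lemma haar_int_swap (h : G * G -> R) : continuous h ->
  I (fun x => I (fun y => h (x, y))) = I (fun y => I (fun x => h (x, y))).
Proof. exact: Rintegral_swap. Qed.

Lemma measurable_translate (a : G) :
  measurable_fun setT ((fun x => a + x) : borel G -> borel G).
Proof.
apply: measurability; first by [].
move=> _ [A oA <-]; rewrite setTI; apply: sub_sigma_algebra.
by apply: open_comp oA => x _; move: x; cont.
Qed.

Lemma haar_int_translate a f : continuous f -> I (fun x => f (a + x)) = I f.
Proof.
move=> cf; have mT := measurable_translate a.
have cfa : continuous (fun x => f (a + x)) by apply: cont_comp => //; cont.
pose t : borel G -> borel G := fun x => (a + x : G).
congr fine; transitivity (\int[pushforward mu t]_x (f x)%:E)%E.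
  rewrite integral_pushforward//=.
  - by apply/measurable_realfun.measurable_EFinP; exact: continuous_borel_measurable.
  - by rewrite preimage_setT; exact: continuous_integrable.
apply: eq_measure_integral => A mA _; rewrite /pushforward/=.
rewrite -[RHS](mu_invariant (- a) mA); congr (mu _).
apply/seteqP; split => [x/= Aax|x/= [y Ay <-]].
  by exists (a + x); rewrite ?addKr.
by rewrite /t addNKr.
Qed.

Lemma haar_int_translater a f : continuous f -> I (fun x => f (x + a)) = I f.
Proof.
by move=> cf; under eq_haar_int do rewrite addrC; exact: haar_int_translate.
Qed.

(** Translation invariance suffices: integrate [f (y - x)] over both variables. Integrating first in
    [x] gives the left side, first in [y] the right side. *)
Lemma haar_int_opp f : continuous f -> I (fun x => f (- x)) = I f.
Proof.
move=> cf.
have cfN : continuous (fun x => f (- x)) by apply: cont_comp => //; cont.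
rewrite -[LHS]haar_int_cst -[RHS]haar_int_cst.
transitivity (I (fun y => I (fun x => f (y - x)))).
  apply: eq_haar_int => y.
  rewrite -(haar_int_translate (- y) cfN); apply: eq_haar_int => x.
  by rewrite opprD opprK.
rewrite -(@haar_int_swap (fun z => f (z.2 - z.1))); last first.
  by apply: cont_comp => //; cont.
by apply: eq_haar_int => x /=; exact: (haar_int_translater (- x) cf).
Qed.

Lemma haar_int_reflect a f : continuous f -> I (fun x => f (a - x)) = I f.
Proof.
move=> cf; rewrite -(haar_int_opp cf).
rewrite -(@haar_int_translater (- a) (fun x => f (- x))).
  by apply: eq_haar_int => x; rewrite opprB.
by apply: cont_comp => //; cont.
Qed.

(* Finitely many translates of [f > f x0 / 2] cover the group. *)
Lemma haar_int_eq0 f : continuous f -> (forall x, 0 <= f x) -> I f = 0 ->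
  forall x, f x = 0.
Proof.
move=> cf f0 If x0; apply/eqP; apply/negP => /negP fx0.
have {}fx0 : 0 < f x0 by rewrite lt_neqAle eq_sym fx0 f0.
pose c := f x0 / 2.
have ct a : continuous (fun x => f (x - a)) by apply: cont_comp => //; cont.
have [D _ hD] : finite_subset_cover [set: G] (fun a => [set x | c < f (x - a)]) [set: G].
  apply: (compact_cover_zmod Gcompact).
    move=> a _; apply: (@open_comp _ _ (fun x => f (x - a)) [set y | c < y]); last exact: open_gt.
    by move=> x _; exact: ct.
  by move=> x _; exists (x - x0) => //=; rewrite opprB addrC subrK /c; lra.
have : c <= I (fun x => \sum_(a <- D) f (x - a)).
  rewrite -[leLHS]haar_int_cst; apply: le_haar_int.
  - exact: cst_continuous.
  - elim: (enum_fset D) => [|a s IHs].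
      by under eq_fun do rewrite big_nil; exact: cst_continuous.
    by under eq_fun do rewrite big_cons; exact: contD.
  - move=> x; have [a /= aD cx] := hD x Logic.I.
    by rewrite (big_rem a)//= (le_trans (ltW cx))// lerDl sumr_ge0.
rewrite haar_int_sum// big1 ?leNgt ?divr_gt0// => a _.
by rewrite haar_int_translater.
Qed.

End HaarIntegral.

(** * Convolution and its idempotents *)

Section Convolution.
Context (R : realType) (G : topologicalZmodType) (mu : probability (borel G) R).
Hypothesis Gcompact : compact [set: G].
Hypothesis Gmetrizable : metrizable R G.
Hypothesis mu_invariant : haar_invariant mu.
Implicit Types (f g h p q : G -> R).
Local Notation I := (haar_int mu).

Definition conv f g x : R := I (fun y => f y * g (x - y)).
Local Infix "**" := conv (at level 40, left associativity).

Lemma conv_integrand_continuous f g : continuous f -> continuous g ->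
  continuous (fun z : G * G => f z.2 * g (z.1 - z.2)).
Proof. by move=> cf cg; apply: contM; apply: cont_comp => //; cont. Qed.

Lemma cont_slice (h : G * G -> R) x : continuous h -> continuous (fun y => h (x, y)).
Proof. by move=> ch; apply: cont_comp => //; apply: cont_pair; cont. Qed.

Lemma cont_conv f g : continuous f -> continuous g -> continuous (f ** g).
Proof.
move=> cf cg.
exact (continuous_haar_int (mu := mu) Gcompact (conv_integrand_continuous cf cg)).
Qed.

Lemma cont_conv1 f g x : continuous f -> continuous g -> continuous (fun y => f y * g (x - y)).
Proof.
move=> cf cg; exact (cont_slice (x := x) (conv_integrand_continuous cf cg)).
Qed.

Lemma convC f g : continuous f -> continuous g -> f ** g =1 g ** f.
Proof.
move=> cf cg x; rewrite /conv -(haar_int_reflect Gcompact Gmetrizable mu_invariant x).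
  by apply: eq_haar_int => y; rewrite subKr mulrC.
exact: cont_conv1.
Qed.

Lemma convA f g h : continuous f -> continuous g -> continuous h ->
  f ** (g ** h) =1 f ** g ** h.
Proof.
move=> cf cg ch x; rewrite /conv.
have cH : continuous (fun z : G * G => f z.1 * g (z.2 - z.1) * h (x - z.2)).
  by apply: contM; [apply: contM|]; apply: cont_comp => //; cont.
transitivity (I (fun z => I (fun y => f z * g (y - z) * h (x - y)))).
  apply: eq_haar_int => z.
  rewrite -haar_intZ//; last exact: cont_conv1.
  rewrite -(haar_int_translater Gcompact mu_invariant (- z)); last first.
    by apply: contZ; exact: cont_conv1.
  apply: eq_haar_int => y; rewrite mulrA; congr (_ * h _).
  by rewrite opprB addrA subrK.
rewrite (haar_int_swap mu Gcompact Gmetrizable cH).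
apply: eq_haar_int => y; rewrite mulrC -haar_intZ//; last exact: cont_conv1.
by apply: eq_haar_int => z /=; rewrite mulrC.
Qed.

Lemma convDr f g h : continuous f -> continuous g -> continuous h ->
  f ** (fun x => g x + h x) =1 (fun x => (f ** g) x + (f ** h) x).
Proof.
move=> cf cg ch x; rewrite /conv -haar_intD//; try exact: cont_conv1.
by apply: eq_haar_int => y; rewrite mulrDr.
Qed.

Lemma convBr f g h : continuous f -> continuous g -> continuous h ->
  f ** (fun x => g x - h x) =1 (fun x => (f ** g) x - (f ** h) x).
Proof.
move=> cf cg ch x; rewrite /conv -haar_intB//; try exact: cont_conv1.
by apply: eq_haar_int => y; rewrite mulrBr.
Qed.

Lemma convZr c f g : continuous f -> continuous g ->
  f ** (fun x => c * g x) =1 (fun x => c * (f ** g) x).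
Proof.
move=> cf cg x; rewrite /conv -haar_intZ//; last exact: cont_conv1.
by apply: eq_haar_int => y; rewrite mulrCA.
Qed.

Lemma conv_translater f g a x : (f ** (fun x => g (x + a))) x = (f ** g) (x + a).
Proof. by apply: eq_haar_int => y; rewrite addrAC. Qed.

Lemma conv_norm f g A B : continuous f -> continuous g ->
  (forall x, `|f x| <= A) -> (forall x, `|g x| <= B) ->
  forall x, `|(f ** g) x| <= A * B.
Proof.
move=> cf cg fA gB x; apply: haar_int_norm => //; first exact: cont_conv1.
by move=> y; rewrite normrM ler_pM.
Qed.

Lemma haar_int_sqr_ge0 f : 0 <= I (fun x => f x ^+ 2).
Proof. by apply: haar_int_ge0 => x; exact: sqr_ge0. Qed.

Lemma cauchy_schwarz f g : continuous f -> continuous g ->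
  I (fun x => f x * g x) ^+ 2 <= I (fun x => f x ^+ 2) * I (fun x => g x ^+ 2).
Proof.
move=> cf cg; set A := I (fun x => f x ^+ 2); set C := I (fun x => g x ^+ 2).
set B := I _.
have c2 (k : G -> R) : continuous k -> continuous (fun x => k x ^+ 2).
  by move=> ck; under eq_fun do rewrite expr2; exact: contM.
have quad s t : 0 <= s ^+ 2 * A - 2 * s * t * B + t ^+ 2 * C.
  have := haar_int_sqr_ge0 (fun x => s * f x - t * g x).
  rewrite (_ : I _ = I (fun x => (s ^+ 2 * f x ^+ 2 - (2 * s * t) * (f x * g x))
                                + t ^+ 2 * g x ^+ 2)); last first.
    by apply: eq_haar_int => x; ring.
  have cf2 : continuous (fun x => s ^+ 2 * f x ^+ 2) by apply: contZ; exact: c2.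
  have cg2 : continuous (fun x => t ^+ 2 * g x ^+ 2) by apply: contZ; exact: c2.
  have cfg : continuous (fun x => (2 * s * t) * (f x * g x)).
    by apply: contZ; exact: contM.
  rewrite haar_intD// ?haar_intB//; last exact: contB.
  by rewrite !haar_intZ//; try exact: c2; exact: contM.
have A0 : 0 <= A := haar_int_sqr_ge0 f.
have C0 : 0 <= C := haar_int_sqr_ge0 g.
move: A0 C0 quad; clear; move: A B C => A B C A0 C0 quad.
have [C1|C1] := ltrP 0 C.
  (* At [s = C], [t = B] the form equals [C * (A * C - B ^+ 2)]. *)
  rewrite -(ler_pM2l C1); have := quad C B; nra.
have {C0 C1} C0 : C = 0 by apply/le_anti/andP.
rewrite {}C0 in quad *.
rewrite mulr0; have [->|B0] := eqVneq B 0; first by rewrite expr0n.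
(* With [C = 0] and [B != 0] the form is affine in [t]; this [t] gives it the value
   [A - (A + 1) < 0]. *)
have := quad 1 ((A + 1) / (2 * B)); rewrite mulr0.
have -> : 2 * 1 * ((A + 1) / (2 * B)) * B = A + 1 by field.
by rewrite expr1n => ?; exfalso; lra.
Qed.

(** Convolution by a real even function is a self-adjoint operator, and for even [g] the value of
    [f ** g] at 0 is the L^2 inner product of [f] and [g]. *)
Definition even_cont f := continuous f /\ forall x, f (- x) = f x.

Lemma even_cont_conv f g : even_cont f -> even_cont g -> even_cont (f ** g).
Proof.
move=> [cf ef] [cg eg]; split; first exact: cont_conv.
move=> x; rewrite /conv -(haar_int_opp Gcompact Gmetrizable mu_invariant); last exact: cont_conv1.
by apply: eq_haar_int => y; rewrite ef -opprD eg.
Qed.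

Lemma conv_at0 f g : even_cont g -> (f ** g) 0 = I (fun x => f x * g x).
Proof. by move=> [cg eg]; apply: eq_haar_int => y; rewrite sub0r eg. Qed.

Lemma conv_self0 f : even_cont f -> (f ** f) 0 = I (fun x => f x ^+ 2).
Proof. by move=> ef; rewrite conv_at0//; apply: eq_haar_int => x; rewrite expr2. Qed.

(** Cauchy-Schwarz for [f] and a reflected translate of [g]. One convolution thus turns L^2
    estimates into uniform ones. *)
Lemma conv_sqr_le f g x : continuous f -> even_cont g ->
  (f ** g) x ^+ 2 <= I (fun x => f x ^+ 2) * I (fun x => g x ^+ 2).
Proof.
move=> cf [cg eg]; have cgx : continuous (fun y => g (x - y)).
  by apply: cont_comp => //; cont.
apply: le_trans (cauchy_schwarz cf cgx) _.
rewrite (@haar_int_reflect _ _ _ Gcompact Gmetrizable mu_invariant x (fun y => g y ^+ 2))//.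
by under eq_fun do rewrite expr2; exact: contM.
Qed.

Lemma conv_self_le f x : even_cont f -> `|(f ** f) x| <= (f ** f) 0.
Proof.
move=> ef; have := conv_sqr_le x ef.1 ef; rewrite -conv_self0// -expr2.
by rewrite -[X in X <= _]real_normK ?num_real// ler_sqr ?nnegrE// conv_self0// haar_int_sqr_ge0.
Qed.

Lemma conv_self_gt0 f : even_cont f -> (exists x, f x != 0) -> 0 < (f ** f) 0.
Proof.
move=> ef [x fx]; rewrite conv_self0// lt_neqAle haar_int_sqr_ge0 andbT eq_sym.
apply/eqP => /(haar_int_eq0 Gcompact mu_invariant).
move=> /(_ _ _ x)/=; have cf2 : continuous (fun x => f x ^+ 2).
  by under eq_fun do rewrite expr2; apply: contM; exact: ef.1.
by move=> /(_ cf2 (fun x => sqr_ge0 _))/eqP; rewrite sqrf_eq0 (negbTE fx).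
Qed.

End Convolution.

(** The restriction [e <= 1] lets a caller bound an approximant of [p] by a bound for [p] plus 1,
    which keeps the error linear in [e]. *)
Lemma eq_of_small (R : realType) (a b K : R) : 0 <= K ->
  (forall e, 0 < e -> e <= 1 -> `|a - b| <= K * e) -> a = b.
Proof.
move=> K0 h; apply/eqP; rewrite -subr_eq0 -normr_eq0; apply/eqP.
apply/le_anti; rewrite normr_ge0 andbT; apply/ler_addgt0Pr => e e0; rewrite add0r.
have K1 : 0 < K + 1 by lra.
have m0 : 0 < Num.min 1 (e / (K + 1)) by rewrite lt_min ltr01 divr_gt0.
have := h _ m0; rewrite ge_min lexx => /(_ isT) /le_trans; apply.
have h1 : Num.min 1 (e / (K + 1)) <= e / (K + 1) by rewrite ge_min lexx orbT.
apply: le_trans (ler_wpM2l K0 h1) _.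
by rewrite mulrA ler_pdivrMr// mulrC ler_pM2l//; lra.
Qed.

Lemma norm_le_of_sqr (R : realType) (z c : R) : 0 <= c ->
  z ^+ 2 <= c ^+ 2 -> `|z| <= c.
Proof. by move=> c0; rewrite -[z ^+ 2]real_normK ?num_real// ler_sqr ?nnegrE. Qed.

(* The growth rate of a log-convex submultiplicative sequence is the limit of its ratios. *)
Lemma growth_rate (R : realType) (al : nat -> R) :
  (forall n, 0 < al n) ->
  (forall n, al n.+1 ^+ 2 <= al n * al n.+2) ->
  (forall n m, al (n + m).+1 <= al n * al m) ->
  exists2 lam, 0 < lam & (forall n, lam ^+ n.+1 <= al n) /\
    (forall n, al n.+1 <= lam * al n).
Proof.
move=> al0 lc sm; pose r n := al n.+1 / al n.
have rle n m : (n <= m)%N -> r n <= r m.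
  apply: (homo_leq (@lexx _ R) (@le_trans _ R)) => {m}n.
  rewrite /r ler_pdivrMr// mulrAC ler_pdivlMr// -expr2 [leRHS]mulrC.
  exact: lc.
have rb n : r n <= al 0%N.
  rewrite /r ler_pdivrMr//; have := sm 0%N n.
  by rewrite add0n.
have rcvg : cvgn r.
  apply: nondecreasing_is_cvgn; first by move=> n m; exact: rle.
  by exists (al 0%N) => _ [n _ <-].
pose lam := limn r.
have rlam n : r n <= lam.
  by apply: nondecreasing_cvgn_le => //; move=> i j; exact: rle.
have r0 n : 0 < r n by rewrite divr_gt0.
exists lam; first by rewrite (lt_le_trans (r0 0%N)).
split=> n; last by rewrite -ler_pdivrMr//; exact: rlam.
(* The ratios increase, so [k] steps from [m] multiply by at least [r m ^+ k]. Comparing with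
   submultiplicativity for [k = n + 1] bounds [r m ^+ n.+1] by [al n]; then [m] tends to
   infinity. *)
have rX m k : r m ^+ k * al m <= al (k + m)%N.
  elim: k => [|k IHk]; first by rewrite mul1r.
  rewrite exprS -mulrA (le_trans (ler_wpM2l (ltW (r0 m)) IHk))//.
  rewrite -ler_pdivlMr// addSn -/(r (k + m)%N); apply: rle; exact: leq_addl.
have rXle m : r m ^+ n.+1 <= al n.
  rewrite -(ler_pM2r (al0 m)); apply: le_trans (rX _ _) _.
  exact: sm.
have : (fun m => r m ^+ n.+1) @ \oo --> lam ^+ n.+1.
  exact: (cvg_comp r (fun x : R => x ^+ n.+1) rcvg (@exprn_continuous R n.+1 lam)).
by move=> /cvgr_to_le; apply; exact: nearW.
Qed.

Lemma uniform_cauchy_limit (R : realType) (T : topologicalType) (U : nat -> T -> R) :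
  (forall n, continuous (U n)) ->
  (forall e, 0 < e -> exists N, forall n m, (N <= n)%N -> (N <= m)%N ->
     forall x, `|U n x - U m x| <= e) ->
  exists2 p : T -> R, continuous p &
    forall e, 0 < e -> exists N, forall n, (N <= n)%N -> forall x, `|U n x - p x| <= e.
Proof.
move=> cU Ucauchy.
have Ucvg x : cvgn (U ^~ x).
  apply/cauchy_cvgP/cauchy_exP => e e0.
  have [|N hN] := Ucauchy (e / 2); first by rewrite divr_gt0.
  exists (U N x); exists N => //= n Nn; rewrite /ball/=.
  by rewrite (le_lt_trans (hN _ _ _ _ x))//; lra.
pose p x := limn (U ^~ x).
have Up e : 0 < e -> exists N, forall n, (N <= n)%N -> forall x, `|U n x - p x| <= e.
  move=> e0; have [N hN] := Ucauchy e e0; exists N => n Nn x.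
  apply/ler_addgt0Pr => d d0.
  have /cvgrPdist_le/(_ d d0)[M _ hM] := Ucvg x.
  have := hM (maxn N M) (leq_maxr _ _); have := hN n (maxn N M) Nn (leq_maxl _ _) x.
  rewrite -/(p x) (distrC (p x)) => h1 h2.
  by rewrite -(subrKA (U (maxn N M) x)) (le_trans (ler_normD _ _))// lerD.
exists p => // x; apply/cvgrPdist_le => e e0.
have [|N hN] := Up (e / 3); first by rewrite divr_gt0.
have /cvgrPdist_le/(_ (e / 3)) := cU N x; rewrite divr_gt0// => /(_ isT).
apply: filterS => y; have := hN N (leqnn _) x; have := hN N (leqnn _) y.
rewrite !ler_norml; lra.
Qed.

(** * Normalized convolution powers and their idempotent limit *)

Section PowerIteration.
Context (R : realType) (G : topologicalZmodType) (mu : probability (borel G) R).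
Hypothesis Gcompact : compact [set: G].
Hypothesis Gmetrizable : metrizable R G.
Hypothesis mu_invariant : haar_invariant mu.
Local Notation I := (haar_int mu).
Local Infix "**" := (conv mu) (at level 40, left associativity).

Let cA (f g h : G -> R) : continuous f -> continuous g -> continuous h ->
  f ** (g ** h) = f ** g ** h.
Proof. by move=> cf cg ch; apply/funext; exact: convA. Qed.

Let cC (f g : G -> R) : continuous f -> continuous g -> f ** g = g ** f.
Proof. by move=> cf cg; apply/funext; exact: convC. Qed.

Section Powers.
Variable P : nat -> G -> R.
Hypothesis Pec : forall n, even_cont (P n).
Hypothesis PM : forall n m, P n ** P m = P (n + m).+1.
Hypothesis P_gt0 : forall n, 0 < P n.*2.+1 0.

Let Pc n : continuous (P n). Proof. exact: (Pec n).1. Qed.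

(** [P n] plays the role of the power of exponent [n + 1], so [P n.*2.+1] is the square of [P n] and
    [al n] is the squared L^2 norm of [P n]. *)
Let al n := P n.*2.+1 0.

Let alE n : al n = I (fun x => P n x ^+ 2).
Proof. by rewrite -(conv_self0 _ (Pec n)) PM addnn. Qed.

(** Cauchy-Schwarz for [P n] and [P n.+2], whose inner product is also the squared norm of
    [P n.+1]. *)
Let al_logconvex n : al n.+1 ^+ 2 <= al n * al n.+2.
Proof.
rewrite !alE; apply: le_trans _ (cauchy_schwarz mu Gcompact (@Pc n) (@Pc n.+2)).
rewrite -(conv_at0 _ _ (Pec _)) -(conv_self0 _ (Pec n.+1)) !PM.
by rewrite addSnnS.
Qed.

Let al_submult n m : al (n + m).+1 <= al n * al m.
Proof.
have -> : al (n + m).+1 = (P n.*2.+1 ** P m.*2.+1) 0.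
  by rewrite PM /al addSn addnS -doubleD.
have b k x : `|P k.*2.+1 x| <= al k.
  by rewrite /al -addnn -PM; apply: conv_self_le (Pec k).
apply: le_trans (ler_norm _) _.
exact: conv_norm.
Qed.

(* Inner products of powers depend only on the sum of the exponents, so the normalized powers *)
(* are Cauchy in L^2; one more convolution makes the convergence uniform.                     *)
Lemma conv_powers_limit : exists p lam,
  [/\ even_cont p, p ** p = p, exists x, p x != 0, 0 < lam &
      P 1%N ** p = (fun x => lam * p x)].
Proof.
have [lam lam0 [lamle lamge]] := growth_rate (al := al) P_gt0 al_logconvex al_submult.
pose be n := al n / lam ^+ n.+1.
have lamX n : 0 < lam ^+ n by rewrite exprn_gt0.
have be1 n : 1 <= be n by rewrite ler_pdivlMr// mul1r.
have beS n : be n.+1 <= be n.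
  by rewrite /be ler_pdivrMr// [lam ^+ n.+2]exprS mulrCA divfK ?gt_eqF.
have becvg : cvgn be.
  apply: nonincreasing_is_cvgn; first exact/nonincreasing_seqP.
  by exists 1 => _ [n _ <-].
(* Only even exponents are kept. [lam] is the growth rate per two exponents, so [U n] is the
   [(n+1)]-st power of [P 1] divided by [lam ^+ n.+1], and [U n] has value [be n] at 0. *)
pose U n : G -> R := fun x => (lam ^+ n.+1)^-1 * P n.*2.+1 x.
have Uec n : even_cont (U n).
  by split=> [|x]; [exact/contZ/Pc|rewrite /U (Pec _).2].
have Uc n : continuous (U n) := (Uec n).1.
have UM n m : U n ** U m = U (n + m).+1.
  apply/funext => x; rewrite /U convZr//; last exact: contZ.
  rewrite cC//; last exact: contZ.
  rewrite convZr// cC// PM mulrA -invfM -exprD.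
  by congr ((_ ^+ _)^-1 * P _ x); lia.
have Uin n m : I (fun x => U n x * U m x) = be (n + m).+1.
  by rewrite -(conv_at0 _ _ (Uec _)) UM /U /be mulrC.
have Udist n m : I (fun x => (U n x - U m x) ^+ 2) =
    be (n + n).+1 - 2 * be (n + m).+1 + be (m + m).+1.
  rewrite -!Uin -haar_intZ//; last exact: contM.
  have c1 i j : continuous (fun x => U i x * U j x) by exact: contM.
  rewrite -haar_intB//; last exact: contZ.
  rewrite -haar_intD//; last by apply: contB => //; exact: contZ.
  by apply: eq_haar_int => x; ring.
have phiU n : P 1 ** U n = (fun x => lam * U n.+1 x).
  rewrite /U; apply/funext => x; rewrite convZr// PM add1n doubleS [in RHS]exprS.
  by rewrite mulrA invfM mulVKf ?gt_eqF.
have Ucauchy e : 0 < e -> exists N, forall n m, (N <= n)%N -> (N <= m)%N ->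
    forall x, `|U n x - U m x| <= e.
  move=> e0.
  pose K := I (fun x => P 1 x ^+ 2) + 1.
  have K0 : 0 < K by have := haar_int_sqr_ge0 mu (P 1); rewrite /K; lra.
  (* [lam * (U n.+1 - U m.+1)] is [P 1] convolved with [U n - U m]. The squared norm of [P 1] is at
     most [K], and that of the difference is a combination of values of [be] with coefficients 1,
     -2, 1, hence at most [4 * d]. *)
  pose d := (lam * e) ^+ 2 / (4 * K).
  have d0 : 0 < d by rewrite divr_gt0 ?mulr_gt0// exprn_gt0// mulr_gt0.
  have /cvgrPdist_le/(_ d d0)[N _ hN] := becvg.
  exists N.+1 => -[//|n] [//|m]; rewrite !ltnS => Nn Nm x.
  rewrite -(ler_pM2l lam0) -[in leLHS](gtr0_norm lam0) -normrM mulrBr.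
  have := congr1 (fun f => f x) (phiU n); have /= <- := congr1 (fun f => f x) (phiU m).
  move=> <-; rewrite -convBr//.
  apply: norm_le_of_sqr; first by rewrite mulr_ge0 ?ltW.
  apply: le_trans (conv_sqr_le Gcompact Gmetrizable mu_invariant x (@Pc 1) _) _.
    by split=> [|y]; [exact: contB|rewrite (Uec n).2 (Uec m).2].
  rewrite Udist.
  have b k : (N <= k)%N -> `|limn be - be k.+1| <= d.
    by move=> Nk; apply: hN => /=; rewrite ltnW.
  have := b (n + n)%N (leq_trans Nn (leq_addr _ _)).
  have := b (n + m)%N (leq_trans Nn (leq_addr _ _)).
  have := b (m + m)%N (leq_trans Nm (leq_addr _ _)).
  rewrite !ler_norml => b1 b2 b3.
  have hd : be (n + n).+1 - 2 * be (n + m).+1 + be (m + m).+1 <= 4 * d by lra.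
  apply: le_trans (ler_wpM2l (haar_int_sqr_ge0 mu (P 1)) hd) _.
  have -> : (lam * e) ^+ 2 = K * (4 * d) by rewrite /d; field; rewrite gt_eqF.
  by apply: ler_wpM2r; [rewrite mulr_ge0// ltW|rewrite lerDl].
have [p cp Up] := uniform_cauchy_limit Uc Ucauchy.
have [M M0 pM] := continuous_bounded Gcompact cp.
have pec : even_cont p.
  split=> // x; apply: (@eq_of_small _ _ _ 2) => // e e0 _.
  have [N hN] := Up _ e0; have := hN N (leqnn _) x; have := hN N (leqnn _) (- x).
  by rewrite (Uec _).2 !ler_norml; lra.
have [A A0 PA] := continuous_bounded Gcompact (@Pc 1).
exists p, lam; split=> //.
(* With [U = U N]: [U ** U - p] is the sum of [U ** (U - p)], [p ** (U - p)] and [p ** p - p]. The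
   first two are bounded by [(M + 1) * e] and [M * e], and the left side by [e], since [U ** U] is
   again a term of the sequence. *)
- apply/funext => x; apply: (@eq_of_small _ _ _ (M + 1 + M + 1)) => [|e e0 e1]; first by lra.
  have [N hN] := Up _ e0; have cD : continuous (fun x => U N x - p x) by exact: contB.
  have UN1 y : `|U N y| <= M + 1.
    rewrite -(subrK (p y) (U N y)) (le_trans (ler_normD _ _))// addrC lerD//.
    exact: le_trans (hN _ _ _) e1.
  have h1 := conv_norm mu Gcompact (Uc N) cD UN1 (hN N (leqnn _)) x.
  have h2 := conv_norm mu Gcompact cp cD pM (hN N (leqnn _)) x.
  have h3 := hN (N + N).+1 (leqW (leq_addr _ _)) x.
  move: h1 h2 h3; rewrite !convBr// -UM (cC cp (Uc N)) !ler_norml; lra.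
(* The limit survives at 0, where [U N] has the value [be N >= 1]. *)
- exists 0; rewrite gt_eqF//.
  have [|N hN] := Up (1 / 2) _; first by rewrite divr_gt0.
  have := hN N (leqnn _) 0; have := be1 N; rewrite /be mulrC -/(U N 0) ler_norml; lra.
- apply/funext => x; apply: (@eq_of_small _ _ _ (A + lam)) => [|e e0 e1]; first by lra.
  have [N hN] := Up _ e0; have cD : continuous (fun x => U N x - p x) by exact: contB.
  have h1 := conv_norm mu Gcompact (@Pc 1) cD PA (hN N (leqnn _)) x.
  have h2 := ler_wpM2l (ltW lam0) (hN N.+1 (leqW (leqnn _)) x).
  move: h2; rewrite -[in leLHS](gtr0_norm lam0) -normrM mulrBr.
  have /= <- := congr1 (fun f => f x) (phiU N).
  by move: h1; rewrite convBr// !ler_norml; lra.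
Qed.

End Powers.

Variable q : G -> R.
Hypothesis qec : even_cont q.
Hypothesis q0 : exists x, q x != 0.

Let P n := iter n (conv mu q) q.

Let Pec n : even_cont (P n).
Proof. by elim: n => [//|n IHn] /=; exact: even_cont_conv. Qed.

Let Pc n : continuous (P n). Proof. exact: (Pec n).1. Qed.

Let PM n m : P n ** P m = P (n + m).+1.
Proof.
elim: n => [|n IHn]; first by rewrite add0n.
by rewrite [P n.+1]/= -cA ?IHn//; exact: qec.1.
Qed.

(** The square of a nonzero even function is positive at 0, so doubling the exponent yields nonzero
    powers of arbitrarily high exponent; a nonzero power forces all lower ones to be nonzero. *)
Let P_gt0 n : 0 < P n.*2.+1 0.
Proof.
suff h k : exists x, P k x != 0.
  by have := conv_self_gt0 Gcompact mu_invariant (Pec n) (h n); rewrite PM addnn.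
have h2 j : (exists x, P j x != 0) -> exists x, P j.*2.+1 x != 0.
  move=> hj; exists 0; rewrite gt_eqF//.
  by have := conv_self_gt0 Gcompact mu_invariant (Pec j) hj; rewrite PM addnn.
have hs j i : (i <= j)%N -> (exists x, P j x != 0) -> exists x, P i x != 0.
  move=> ij; rewrite -(subnK ij); elim: (j - i)%N => [//|l IHl] [x].
  rewrite addSn /= => Px; apply: IHl; apply: contrapT => /forallNP h0.
  move/eqP: Px; apply; rewrite /conv -[RHS](haar_int_cst mu 0).
  by apply: eq_haar_int => y; have /negP := h0 (x - y); rewrite negbK => /eqP ->; rewrite mulr0.
have : exists2 j, (k <= j)%N & exists x, P j x != 0.
  elim: k => [|k [j kj /h2 hj]]; first by exists 0%N.
  exists j.*2.+1 => //; rewrite ltnS (leq_trans kj)// -addnn leq_addr//.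
by move=> [j kj]; exact: hs.
Qed.

Lemma power_iteration : exists p lam,
  [/\ even_cont p, p ** p = p, exists x, p x != 0, 0 < lam &
      q ** q ** p = (fun x => lam * p x)].
Proof. exact: (conv_powers_limit Pec PM P_gt0). Qed.

End PowerIteration.

(** * Characters separate points *)

Section DAlembert.
Context (R : realType) (G : topologicalZmodType).
Variable C : G -> R.
Hypothesis C_continuous : continuous C.
Hypothesis C0 : C 0 = 1.
Hypothesis C_le1 : forall x, `|C x| <= 1.
Hypothesis dalembert : forall x y, C (x + y) + C (x - y) = 2 * C x * C y.

(* The candidate comes from [cos (x - a) - cos (x + a) = 2 sin a sin x], for some [a] with *)
(* [sin a <> 0]; if there is none, the sine is 0.                                           *)
Lemma dalembert_sine : exists S : G -> R, [/\ continuous S,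
  forall x, C x ^+ 2 + S x ^+ 2 = 1,
  forall x y, C (x + y) = C x * C y - S x * S y &
  forall x y, S (x + y) = S x * C y + C x * S y].
Proof.
have [[a Ca]|h] := pselect (exists a, C a ^+ 2 <> 1); last first.
  have C1 x : C x ^+ 2 = 1 by apply: contrapT => hx; apply: h; exists x.
  exists (fun=> 0); split=> [|x|x y|x y]; rewrite ?expr0n ?mulr0 ?mul0r ?addr0 ?subr0 //.
    exact: cst_continuous.
  have := dalembert x y; have := C1 (x + y); have := C1 (x - y).
  (* [C (x + y)], [C (x - y)] and [C x * C y] are all 1 or -1, and the cosine equation then forces
     them to agree. *)
  have : (C x * C y) ^+ 2 = 1 by rewrite exprMn !C1 mulr1.
  have pm (z : R) : z ^+ 2 = 1 -> z = 1 \/ z = -1.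
    move/eqP; rewrite sqrf_eq1 => /orP[] /eqP ->; [by left|by right].
  by rewrite -mulrA => /pm[]-> /pm[]-> /pm[]->; lra.
have s0 : 0 < 1 - C a ^+ 2.
  rewrite subr_gt0 lt_neqAle; apply/andP; split; first exact/eqP.
  by rewrite -real_normK ?num_real// expr_le1.
pose s := Num.sqrt (1 - C a ^+ 2).
have s2 : s ^+ 2 = 1 - C a ^+ 2 by rewrite sqr_sqrtr// ltW.
have sn0 : s != 0 by rewrite sqrtr_eq0 -ltNge.
have C2 x y : C x * C y = (C (x + y) + C (x - y)) / 2 by rewrite dalembert; field.
pose S x := (C (x - a) - C (x + a)) / (2 * s).
have SE x : 2 * s * S x = C (x - a) - C (x + a).
  by rewrite /S mulrC divfK// mulf_neq0.
have C2a : C (a + a) = 2 * C a ^+ 2 - 1.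
  by have := dalembert a a; rewrite subrr C0 expr2 mulrA; lra.
have SS x y : 2 * (S x * S y) = C (x - y) - C (x + y).
  apply: (mulfI (_ : 4 * s ^+ 2 != 0)); first by rewrite mulf_neq0// expf_neq0.
  have -> : 4 * s ^+ 2 * (2 * (S x * S y)) = 2 * ((2 * s * S x) * (2 * s * S y)) by ring.
  rewrite !SE mulrBl !mulrBr !C2.
  have -> : x - a + (y - a) = x + y - (a + a) by rewrite opprD addrACA.
  have -> : x - a - (y - a) = x - y by rewrite opprB addrA subrK.
  have -> : x - a + (y + a) = x + y by rewrite addrA (addrAC x) subrK.
  have -> : x - a - (y + a) = x - y - (a + a) by rewrite !opprD addrACA.
  have -> : x + a + (y - a) = x + y by rewrite addrA (addrAC x) addrK.
  have -> : x + a - (y - a) = x - y + (a + a) by rewrite opprB (addrC a (- y)) addrACA.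
  have -> : x + a + (y + a) = x + y + (a + a) by rewrite addrACA.
  have -> : x + a - (y + a) = x - y by rewrite opprD addrACA subrr addr0.
  have := dalembert (x + y) (a + a); have := dalembert (x - y) (a + a).
  by rewrite C2a s2; lra.
have CE x y : C (x + y) = C x * C y - S x * S y.
  by have := SS x y; have := dalembert x y; rewrite -mulrA; lra.
exists S; split=> //.
- rewrite /S; under eq_fun do rewrite mulrC; apply: contZ.
  by apply: contB; apply: cont_comp => //; cont.
- move=> x; have := SS x x; have := dalembert x x; rewrite subrr C0 !expr2; lra.
- move=> x y; apply: (mulfI (_ : 2 * s != 0)); first by rewrite mulf_neq0.
  have -> : 2 * s * (S x * C y + C x * S y) = (2 * s * S x) * C y + C x * (2 * s * S y).
    by ring.
  rewrite !SE mulrBl mulrBr !C2.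
  have -> : x - a + y = x + y - a by rewrite addrAC.
  have -> : x + a + y = x + y + a by rewrite addrAC.
  have -> : x - a - y = x - (y + a) by rewrite opprD addrA addrAC.
  have -> : x + a - y = x - (y - a) by rewrite opprB addrA addrAC.
  by rewrite !addrA; lra.
Qed.

Lemma dalembert_character : exists chi : dual R G, forall x, complex.Re (chi x) = C x.
Proof.
have [S [cS CS CD SD]] := dalembert_sine.
pose f x := (C x +i* S x)%C.
have normi (t : R) : `|'i%C * t%:C%C| = `|t|%:C%C.
  by rewrite normc_def -sqrtr_sqr /=; congr ((Num.sqrt _)%:C)%C; ring.
have f_continuous : continuous (f : G -> R[i]^o).
  move=> x; apply/cvgrPdist_lt => e.
  rewrite ltcE => /andP[/= /eqP Ime Ree].
  have e0 : 0 < complex.Re e / 2 by rewrite divr_gt0.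
  have /cvgrPdist_lt/(_ _ e0) c1 := C_continuous (x := x).
  have /cvgrPdist_lt/(_ _ e0) c2 := cS x.
  have eE : e = (complex.Re e)%:C%C by clear -Ime; case: e Ime => a b /= ->.
  apply: filterS2 c1 c2 => y h1 h2; rewrite eE.
  have -> : f x - f y = (C x - C y)%:C%C + 'i%C * (S x - S y)%:C%C.
    by rewrite /f; apply/eqP; rewrite eq_complex/=; apply/andP; split; apply/eqP; ring.
  apply: le_lt_trans (ler_normD _ _) _.
  rewrite normi !norm_real_complex -rmorphD ltcR; lra.
have fD x y : f (x + y) = f x * f y.
  apply/eqP; rewrite eq_complex/= CD SD eqxx/=; apply/eqP; ring.
have fn x : `|f x| = 1 by rewrite /f normc_def/= CS sqrtr1.
by exists (Dual f_continuous fD fn).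
Qed.

End DAlembert.

(** * Minimal convolution idempotents and the characters they determine *)

Section SeparatingCharacters.
Context (R : realType) (G : topologicalZmodType) (mu : probability (borel G) R).
Hypothesis Gcompact : compact [set: G].
Hypothesis Gmetrizable : metrizable R G.
Hypothesis mu_invariant : haar_invariant mu.
Local Notation I := (haar_int mu).
Local Infix "**" := (conv mu) (at level 40, left associativity).

Let cA (f g h : G -> R) : continuous f -> continuous g -> continuous h ->
  f ** (g ** h) = f ** g ** h.
Proof. by move=> cf cg ch; apply/funext; exact: convA. Qed.

Let cC (f g : G -> R) : continuous f -> continuous g -> f ** g = g ** f.
Proof. by move=> cf cg; apply/funext; exact: convC. Qed.

(** In Fourier terms such a [p] is the sum of a finite nonempty set of characters closed under
    inversion, and [p 0] is the size of that set. *)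
Definition idempotent (p : G -> R) :=
  [/\ even_cont p, p ** p = p & exists x, p x != 0].

Lemma idempotent_le p : idempotent p -> forall x, `|p x| <= p 0.
Proof. by move=> [ep pp _] x; rewrite -pp; exact: conv_self_le. Qed.

(** [p 0] is the sup norm of [p], so [p = p ** p] gives [p 0 <= p 0 * p 0]. *)
Lemma idempotent_ge1 p : idempotent p -> 1 <= p 0.
Proof.
move=> pi; have [ep pp p0] := pi.
have p0_gt0 : 0 < p 0 by rewrite -pp; exact: conv_self_gt0.
rewrite -(ler_pM2l p0_gt0) mulr1 -[leLHS](congr1 (fun f => f 0) pp).
apply: le_trans (ler_norm _) _.
by apply: conv_norm => //; [exact: ep.1|exact: ep.1|exact: idempotent_le..].
Qed.

(* A nonzero idempotent has value at least 1 at 0 and these values add up over orthogonal *)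
(* sums, so an idempotent below [e] that nearly minimizes the value at 0 is minimal.      *)
Lemma minimal_idempotent e : idempotent e -> exists p, [/\ idempotent p, p ** e = p &
  forall p', idempotent p' -> p' ** p = p' -> p' = p].
Proof.
move=> ie.
pose V := [set p 0 | p in [set p | idempotent p /\ p ** e = p]].
have hV : has_inf V.
  split; first by exists (e 0), e => //; split=> //; case: ie.
  by exists 1 => _ [p [ip _] <-]; exact: idempotent_ge1.
(* The slack 1 is the least value at 0 of the remainder [p - p']: were it nonzero, [p 0] would be at
   least [inf V + 1]. *)
have [_ [p [ip pe] <-] pV] := inf_adherent (ltr01 : 0 < (1 : R)) hV.
exists p; split=> // p' ip' p'p.
have [[cp ep] pp _] := ip; have [[cp' ep'] pp' _] := ip'; have [[ce _] _ _] := ie.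
apply/funext => x; apply/eqP; apply/negP => /negP p'x.
pose r x := p x - p' x.
have cr : continuous r by exact: contB.
have ir : idempotent r.
  split; last by exists x; rewrite subr_eq0 eq_sym.
    by split=> // y; rewrite /r ep ep'.
  apply/funext => y; rewrite {2}/r convBr// [r ** p]cC// [r ** p']cC// /r.
  by rewrite !convBr// pp pp' p'p (cC cp cp') p'p subrr subr0.
have := idempotent_ge1 ir.
have : inf V <= p' 0.
  apply: ge_inf; first by case: hV.
  by exists p' => //; split=> //; rewrite -p'p -cA// pe.
by move: pV; rewrite /r; lra.
Qed.

(** Power iteration on [q] gives an idempotent [p'] with [q ** q ** p' = lam p']. As [p] acts as
    identity on [q], it does so on [p'], and minimality gives [p' = p]. Then [q ** q = q ** q ** p]
    is a multiple of [p]. *)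
Lemma minimal_idempotent_square p q :
  idempotent p -> (forall p', idempotent p' -> p' ** p = p' -> p' = p) ->
  even_cont q -> q ** p = q -> exists c, q ** q = (fun x => c * p x).
Proof.
move=> ip pmin eq qp; have [[cp _] _ _] := ip; have cq := eq.1.
have [q0|q0] := pselect (exists x, q x != 0); last first.
  exists 0; apply/funext => x; rewrite mul0r /conv -[RHS](haar_int_cst mu 0).
  apply: eq_haar_int => y; rewrite (_ : q y = 0) ?mul0r//.
  by apply/eqP; apply/negP => /negP qy; apply: q0; exists y.
have [p' [lam [ep' pp' p'0 lam0 qqp]]] :=
  power_iteration Gcompact Gmetrizable mu_invariant eq q0.
have cp' := ep'.1; have cqq := cont_conv (mu := mu) Gcompact cq cq.
suff p'p : p' ** p = p' 
  by move: qqp; rewrite (pmin p')// -cA// qp; exists lam.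
have qqE : q ** q ** p = q ** q by rewrite -(cA cq cq cp) qp.
have pqqp' : p ** (q ** q ** p') = q ** q ** p'.
  by rewrite (cA cp cqq cp') (cC cp cqq) qqE.
apply/funext => x; apply: (mulfI (lt0r_neq0 lam0)).
rewrite (cC cp' cp) -(convZr mu Gcompact lam cp cp' x).
by move: pqqp'; rewrite qqp => /(congr1 (fun f => f x)).
Qed.

(** A single translate of an even function need not be even; the symmetric sum is. *)
Definition two_translate a (f : G -> R) x := f (x + a) + f (x - a).

Lemma cont_two_translate a f : continuous f -> continuous (two_translate a f).
Proof. by move=> cf; apply: contD; apply: cont_comp => //; cont. Qed.

Lemma even_cont_two_translate a f : even_cont f -> even_cont (two_translate a f).
Proof.
move=> [cf ef]; split; first exact: cont_two_translate.
by move=> x; rewrite /two_translate -(ef (x + a)) -(ef (x - a)) opprB opprD addrC [a - x]addrC.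
Qed.

Lemma conv_two_translate a f g : continuous f -> continuous g ->
  f ** two_translate a g = two_translate a (f ** g).
Proof.
move=> cf cg; apply/funext => x; rewrite convDr//; last 2 first.
- by apply: cont_comp => //; cont.
- by apply: cont_comp => //; cont.
by rewrite (conv_translater mu f g a) (conv_translater mu f g (- a)).
Qed.

(* By minimality the squares of t and of p + t act as scalars, where t is the two-sided *)
(* translate of p; hence so does t.                                                    *)
Lemma minimal_idempotent_translate p a :
  idempotent p -> (forall p', idempotent p' -> p' ** p = p' -> p' = p) ->
  exists c, two_translate a p = (fun x => c * p x).
Proof.
move=> ip pmin; have [ep pp _] := ip; have cp := ep.1.
have et := even_cont_two_translate a ep; have ct := et.1.
have tp : two_translate a p ** p = two_translate a p.
  by rewrite cC// conv_two_translate// pp.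
have [c0 hc0] := minimal_idempotent_square ip pmin et tp.
pose q x := p x + two_translate a p x.
have eq : even_cont q by split=> [|x]; [exact: contD|rewrite /q ep.2 et.2].
have qp : q ** p = q.
  by rewrite cC//; [apply/funext => x; rewrite /q convDr// pp cC// tp|exact: eq.1].
have [c1 hc1] := minimal_idempotent_square ip pmin eq qp.
(* With [t] the two-sided translate, [(p + t) ** (p + t) = p + 2 t + t ** t]; the left side is
   [c1 p] and [t ** t = c0 p]. *)
exists ((c1 - 1 - c0) / 2); apply/funext => x.
have := congr1 (fun f => f x) hc1.
have /= := congr1 (fun f => f x) hc0.
rewrite {2}/q convDr//; last exact: eq.1.
rewrite qp [q ** _]cC//; last exact: eq.1.
rewrite /q convDr// tp; lra.
Qed.

(** The second difference [q] of an even function [k] with a strict maximum at 0 does not vanish at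
    0, so power iteration yields a minimal [p] with [q ** q ** p] a positive multiple of [p]. If the
    character obtained from [p] had real part 1 at [x0], then [q ** p] would be 0. *)
Lemma characters_separate (x0 : G) : x0 != 0 ->
  exists chi : dual R G, complex.Re (chi x0) < 1.
Proof.
move=> x00; have [d [d0 dC dT dnbhs]] := Gmetrizable.
have dge0 x y : 0 <= d x y.
  have := dT x y x; rewrite (dC y x) (d0 x x).2//; lra.
have cd : continuous (d 0).
  move=> x; apply/cvgrPdist_lt => e e0; have : nbhs x [set b | d x b < e].
    by rewrite dnbhs; exists e.
  apply: filterS => y /= xy.
  have := dT 0 x y; have := dT 0 y x; rewrite (dC y x) ltr_norml; lra.
pose k x := - (d 0 x + d 0 (- x)).
have ck : continuous k.
  rewrite /k; under eq_fun do rewrite -mulN1r; apply: contZ.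
  by apply: contD => //; apply: cont_comp => //; cont.
have ek : even_cont k by split=> // x; rewrite /k opprK addrC.
pose q x := 2 * k x - two_translate x0 k x.
have et := even_cont_two_translate x0 ek; have ct := et.1.
have eq : even_cont q.
  by split=> [|x]; [apply: contB => //; exact: contZ|rewrite /q ek.2 et.2].
have cq := eq.1.
have q0 : exists x, q x != 0.
  exists 0; rewrite /q /two_translate add0r sub0r ek.2 /k oppr0 (d0 0 0).2//.
  rewrite gt_eqF//; have := dge0 0 (- x0).
  have : 0 < d 0 x0.
    by rewrite lt_neqAle dge0 andbT; apply: contra x00 => /eqP/esym/d0 <-.
  lra.
have [e [lam [ee ee2 e0 lam0 qqe]]] :=
  power_iteration Gcompact Gmetrizable mu_invariant eq q0.
have ce := ee.1.
have [p [ip pe pmin]] := minimal_idempotent (And3 ee ee2 e0).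
have [ep pp pn0] := ip; have cp := ep.1.
have p0 : 0 < p 0 by apply: lt_le_trans (idempotent_ge1 ip).
pose C x := p x / p 0.
have cC' : continuous C by apply: contM => //; exact: cst_continuous.
have dal x y : C (x + y) + C (x - y) = 2 * C x * C y.
  have [c hc] := minimal_idempotent_translate y ip pmin.
  have := congr1 (fun f => f 0) hc; have := congr1 (fun f => f x) hc.
  rewrite /two_translate add0r sub0r ep.2 /C => h1 h2.
  have -> : p y = c * p 0 / 2 by lra.
  rewrite -mulrDl h1; field; exact: lt0r_neq0.
have C0 : C 0 = 1 by rewrite /C divff// gt_eqF.
have Cle x : `|C x| <= 1.
  by rewrite /C normrM normfV (gtr0_norm p0) ler_pdivrMr// mul1r idempotent_le.
have [chi hchi] := dalembert_character cC' C0 Cle dal.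
exists chi; rewrite hchi lt_neqAle (le_trans (ler_norm _) (Cle _)) andbT.
apply/eqP => Cx0.
(* The translate is a multiple of [p], and comparison at 0 identifies the factor as 2. Moving the
   translate from [k] to [p] in [q ** p] then makes the two terms cancel. *)
have tp : two_translate x0 p = (fun x => 2 * p x).
  have [c hc] := minimal_idempotent_translate x0 ip pmin.
  have : p (0 + x0) + p (0 - x0) = c * p 0 := congr1 (fun f => f 0) hc.
  rewrite add0r sub0r ep.2; have -> : p x0 = p 0 by rewrite -[RHS]mul1r -Cx0 /C divfK// gt_eqF.
  move=> h; rewrite hc; apply/funext => x; congr (_ * _).
  by apply: (mulIf (lt0r_neq0 p0)); rewrite -h; ring.
have qp x : (q ** p) x = 0.
  rewrite cC// /q convBr//; last exact: contZ.
  rewrite convZr// conv_two_translate// cC// -conv_two_translate// tp convZr//.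
  exact: subrr.
have qqp : q ** q ** p = (fun x => lam * p x).
  rewrite -pe [p ** e]cC// cA//; last exact: cont_conv.
  by rewrite qqe; apply/funext => x; rewrite cC ?convZr// 1?cC//; exact: contZ.
have := congr1 (fun f => f 0) qqp; rewrite -cA//.
rewrite /conv; under eq_haar_int do rewrite -/(conv mu q p _) qp mulr0.
by rewrite haar_int_cst => /esym/eqP; rewrite mulf_eq0 !gt_eqF.
Qed.

End SeparatingCharacters.

(** * Fejer kernels *)

Lemma mulg_eq1_solve (T : groupType) (a b c : T) :
  ((a * b^-1 * c)%g == 1%g) = (b == (c * a)%g).
Proof.
apply/eqP/eqP => [h|->]; last by rewrite invgM mulVKg mulVg.
by rewrite -[a](mulgVK b) -[(a * _)%g](mulgK c) h mul1g mulVKg.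
Qed.

Section Characters.
Context (R : realType) (G : topologicalZmodType).
Implicit Types (xi eta chi : dual R G).
Local Notation Re := complex.Re.
Local Notation Im := complex.Im.

Lemma dual_Re_continuous chi : continuous (fun x => Re (chi x)).
Proof. by have [] := dual_ReIm chi. Qed.

Lemma dual_Im_continuous chi : continuous (fun x => Im (chi x)).
Proof. by have [] := dual_ReIm chi. Qed.

Lemma dual_Re_le1 chi x : Re (chi x) <= 1.
Proof. by have [_ _ h _] := dual_ReIm chi; exact: le_trans (ler_norm _) (h x). Qed.

Lemma dual_0 chi : chi 0 = 1.
Proof.
have chi0 : chi 0 != 0 by rewrite -normr_eq0 dual_norm oner_eq0.
by apply: (mulfI chi0); rewrite -dualD addr0 mulr1.
Qed.

Lemma dual_opp chi x : chi (- x) = (chi^-1)%g x.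
Proof.
have chix0 : chi x != 0 by rewrite -normr_eq0 dual_norm oner_eq0.
by apply: (mulfI chix0); rewrite -dualD subrr dual_0 [in RHS](mulfV chix0).
Qed.

Lemma dual_mulE xi eta x : (xi * eta)%g x = xi x * eta x.
Proof. by []. Qed.

Lemma dual_Re_mul xi chi x : Re (xi x) * Re (chi x) =
  (Re ((xi * chi)%g x) + Re ((xi * chi^-1)%g x)) / 2.
Proof.
rewrite !dual_mulE -dual_conj; case: (xi x) (chi x) => a b [c e] /=; lra.
Qed.

Section Orthogonality.
Variable mu : probability (borel G) R.
Hypothesis Gcompact : compact [set: G].
Hypothesis mu_invariant : haar_invariant mu.

(** Translation by [a] multiplies the integral by [chi a]; choose [a] with [chi a <> 1]. *)
Lemma cint_char chi : cintegral mu chi = (chi == 1%g)%:R.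
Proof.
have [->|/eqP chi1] := eqVneq chi 1%g.
  by rewrite /cintegral /= !Rintegral_prob_cst.
have [a chia] : exists a, chi a <> 1.
  apply: contrapT => /forallNP h; apply: chi1; apply: dual_ext => x.
  by apply: contrapT; exact: h.
pose A := haar_int mu (fun x => Re (chi x)); pose B := haar_int mu (fun x => Im (chi x)).
have cR : continuous (fun x => Re (chi x)) by exact: dual_Re_continuous.
have cI : continuous (fun x => Im (chi x)) by exact: dual_Im_continuous.
have hA : A = Re (chi a) * A - Im (chi a) * B.
  rewrite -!haar_intZ// -haar_intB//; try exact: contZ.
  rewrite {1}/A -(haar_int_translate Gcompact mu_invariant a)//.
  by apply: eq_haar_int => x; rewrite dualD complexReM.
have hB : B = Re (chi a) * B + Im (chi a) * A.
  rewrite -!haar_intZ// -haar_intD//; try exact: contZ.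
  rewrite {1}/B -(haar_int_translate Gcompact mu_invariant a)//.
  by apply: eq_haar_int => x; rewrite dualD complexImM.
rewrite -[LHS]/(A +i* B)%C.
have : (A +i* B)%C * (1 - chi a) = 0.
  rewrite mulrBr mulr1; apply/eqP; rewrite subr_eq0 eq_complex complexReM complexImM /=.
  by rewrite mulrC -(mulrC (Im _)) -hA mulrC [B * _]mulrC addrC -hB !eqxx.
move/eqP; rewrite mulf_eq0 subr_eq0 (eq_sym 1) (negbTE (introN eqP chia)) orbF.
by move/eqP.
Qed.

Lemma haar_int_Re chi : haar_int mu (fun x => Re (chi x)) = (chi == 1%g)%:R.
Proof.
by have := congr1 (fun z => Re z) (cint_char chi); rewrite /haar_int /= => ->; case: eqP.
Qed.

End Orthogonality.

Variable Gam : {fset dual R G}.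
Local Notation n := (#|` Gam|%:R : R).

Definition fejer x : R :=
  n^-1 * \sum_(xi <- Gam) \sum_(eta <- Gam) Re ((xi * eta^-1)%g x).

Lemma continuous_sum J (r : seq J) (F : J -> G -> R) : (forall i, continuous (F i)) ->
  continuous (fun x => \sum_(i <- r) F i x).
Proof.
move=> cF; elim: r => [|i r IHr].
  by under eq_fun do rewrite big_nil; exact: cst_continuous.
by under eq_fun do rewrite big_cons; exact: contD.
Qed.

Lemma fejer_continuous : continuous fejer.
Proof.
by apply: contZ; do 2 (apply: continuous_sum => ?); exact: dual_Re_continuous.
Qed.

Lemma fejerE x : fejer x = n^-1 * Re (`|\sum_(xi <- Gam) xi x| ^+ 2).
Proof.
congr (_ * _); rewrite normCK rmorph_sum mulr_suml raddf_sum; apply: eq_bigr => xi _.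
rewrite mulr_sumr raddf_sum; apply: eq_bigr => eta _.
by rewrite dual_mulE -dual_conj.
Qed.

Lemma fejer_ge0 x : 0 <= fejer x.
Proof.
rewrite fejerE mulr_ge0 ?invr_ge0//.
by have : 0 <= `|\sum_(xi <- Gam) xi x| ^+ 2 by []; rewrite lecE => /andP[].
Qed.

Lemma fejer_opp x : fejer (- x) = fejer x.
Proof.
congr (_ * _); rewrite exchange_big; apply: eq_bigr => xi _; apply: eq_bigr => eta _.
by rewrite dual_opp invgM invgK.
Qed.

Hypothesis Gam0 : Gam != fset0.
Variable mu : probability (borel G) R.
Hypothesis Gcompact : compact [set: G].
Hypothesis mu_invariant : haar_invariant mu.

Lemma card_gt0 : 0 < n.
Proof. by rewrite ltr0n cardfs_gt0. Qed.

Lemma sum_dual_fejer x :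
  \sum_(xi <- Gam) \sum_(eta <- Gam) (xi * eta^-1)%g x = (n * fejer x)%:C%C.
Proof.
have -> : \sum_(xi <- Gam) \sum_(eta <- Gam) (xi * eta^-1)%g x = `|\sum_(xi <- Gam) xi x| ^+ 2.
  rewrite normCK rmorph_sum mulr_suml; apply: eq_bigr => xi _.
  by rewrite mulr_sumr; apply: eq_bigr => eta _; rewrite dual_mulE -dual_conj.
rewrite fejerE mulVKf ?gt_eqF ?card_gt0//.
have : 0 <= `|\sum_(xi <- Gam) xi x| ^+ 2 by [].
by case: (`|_| ^+ 2) => a b; rewrite lecE /= => /andP[/eqP ->].
Qed.

Lemma card_fset_natr (s : {fset dual R G}) : #|` s|%:R = \sum_(xi <- s) 1 :> R.
Proof. by rewrite card_fset_sum1 natr_sum. Qed.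

Lemma sum_pred1 (s : {fset dual R G}) xi : \sum_(eta <- s) (eta == xi)%:R = (xi \in s)%:R :> R.
Proof.
have [xis|xis] := boolP (xi \in s).
  rewrite (big_fsetD1 xi)//= eqxx big_seq big1 ?addr0// => eta.
  by rewrite !inE => /andP[/negbTE->].
by rewrite big_seq big1// => eta etas; case: eqP xis => // <-; rewrite etas.
Qed.

(** The product formula for real parts turns each term into an average over [chi] and its inverse.
    By orthogonality [xi * eta^-1 * chi] contributes only for [eta = chi * xi], so the inner sum
    tests membership. *)
Lemma fejer_moment chi : haar_int mu (fun x => fejer x * Re (chi x)) =
  n^-1 * \sum_(xi <- Gam) (((chi * xi)%g \in Gam)%:R + ((chi^-1 * xi)%g \in Gam)%:R) / 2.
Proof.
have cR (zeta : dual R G) : continuous (fun x => Re (zeta x)).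
  exact: dual_Re_continuous.
rewrite -[LHS](_ : haar_int mu (fun x => n^-1 * \sum_(xi <- Gam) \sum_(eta <- Gam)
    2^-1 * (Re ((xi * eta^-1 * chi)%g x) + Re ((xi * eta^-1 * chi^-1)%g x))) = _); last first.
  apply: eq_haar_int => x; rewrite -mulrA mulr_suml; congr (_ * _).
  apply: eq_bigr => xi _; rewrite mulr_suml; apply: eq_bigr => eta _.
  by rewrite dual_Re_mul mulrC.
have c1 xi eta : continuous (fun x => 2^-1 * (Re ((xi * eta^-1 * chi)%g x) +
    Re ((xi * eta^-1 * chi^-1)%g x))) by apply: contZ; exact: contD.
rewrite haar_intZ//; last by do 2 (apply: continuous_sum => ?).
rewrite haar_int_sum//; last by move=> ?; apply: continuous_sum => ?.
congr (_ * _); apply: eq_bigr => xi _; rewrite haar_int_sum//.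
have e eta : haar_int mu (fun x => 2^-1 * (Re ((xi * eta^-1 * chi)%g x) +
    Re ((xi * eta^-1 * chi^-1)%g x))) =
    2^-1 * (((xi * eta^-1 * chi)%g == 1%g)%:R + ((xi * eta^-1 * chi^-1)%g == 1%g)%:R).
  rewrite haar_intZ//; last exact: contD.
  by rewrite haar_intD// !haar_int_Re.
rewrite (eq_bigr _ (fun eta _ => e eta)) {e}.
rewrite -mulr_sumr big_split mulrC /= -!sum_pred1; congr ((_ + _) / 2).
  by apply: eq_bigr => eta _; rewrite mulg_eq1_solve.
by apply: eq_bigr => eta _; rewrite mulg_eq1_solve.
Qed.

Lemma fejer_int1 : haar_int mu fejer = 1.
Proof.
have := fejer_moment 1%g.
rewrite [X in X = _ -> _](_ : _ = haar_int mu fejer); last first.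
  by apply: eq_haar_int => x /=; rewrite mulr1.
move=> ->; rewrite invg1 big_seq (eq_bigr (fun=> 1)) => [|xi xiG].
  by rewrite -big_seq -card_fset_natr mulVf// gt_eqF// card_gt0.
by rewrite mul1g xiG /=; lra.
Qed.

End Characters.

(** * Fejer moments under the Folner condition *)

Section Folner.
Context (R : realType) (G : topologicalZmodType) (mu : probability (borel G) R).
Hypothesis Gcompact : compact [set: G].
Hypothesis mu_invariant : haar_invariant mu.
Variable Gam : nat -> {fset dual R G}.
Hypothesis Gam0 : forall N, Gam N != fset0.
Hypothesis folner : forall eta : dual R G,
    let etaGam N := [fset (eta * xi)%g | xi in Gam N]%fset in
    (fun N => #|` (etaGam N `\` Gam N) `|` (Gam N `\` etaGam N)|%fset%:R
              / #|` Gam N|%:R : R) @ \oo --> (0 : R).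

(** The sum counts the [xi] that [chi] keeps inside [Gam N], so it falls short of the cardinality by
    the size of the part of the translate outside [Gam N], which is contained in the symmetric
    difference. *)
Lemma folner_moment (chi : dual R G) :
  (fun N => (#|` Gam N|%:R : R)^-1 * \sum_(xi <- Gam N) ((chi * xi)%g \in Gam N)%:R)
    @ \oo --> (1 : R).
Proof.
apply/cvgrPdist_le => e e0.
have /cvgrPdist_le/(_ e e0) := folner chi; apply: filterS => N.
set A := [fset (chi * xi)%g | xi in Gam N]%fset; set B := (_ `|` _)%fset => /=.
have n0 := card_gt0 (Gam0 N).
rewrite sub0r normrN ger0_norm ?divr_ge0// => hB.
have -> : \sum_(xi <- Gam N) ((chi * xi)%g \in Gam N)%:R =
    (#|` Gam N|%:R - #|` A `\` Gam N|%fset%:R : R).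
  have <- : #|` A| = #|` Gam N| by rewrite card_imfset//; exact: mulgI.
  rewrite -(cardfsID (Gam N) A).
  rewrite natrD addrK card_fset_natr.
  have -> : (A `&` Gam N = [fset eta in A | eta \in Gam N])%fset.
    by apply/fsetP => eta; rewrite !inE.
  rewrite big_fset /= /A eq_big_imfset /=; last by move=> ? ? _ _ /mulgI.
  by rewrite big_map [RHS]big_mkcond; apply: eq_bigr => xi _; case: ifP.
rewrite mulrBr mulVf ?gt_eqF// opprB addrC subrK ger0_norm ?mulr_ge0 ?invr_ge0//.
apply: le_trans hB; rewrite mulrC ler_pM2r ?invr_gt0// ler_nat.
by apply: fsubset_leq_card; exact: fsubsetUl.
Qed.

Lemma fejer_moment_cvg (chi : dual R G) :
  (fun N => haar_int mu (fun x => fejer (Gam N) x * (1 - complex.Re (chi x)))) @ \oo --> (0 : R).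
Proof.
have cR : continuous (fun x => complex.Re (chi x)) by exact: dual_Re_continuous.
have -> : (fun N => haar_int mu (fun x => fejer (Gam N) x * (1 - complex.Re (chi x)))) =
  (fun N => 1 - ((#|` Gam N|%:R : R)^-1 * \sum_(xi <- Gam N) ((chi * xi)%g \in Gam N)%:R +
    (#|` Gam N|%:R : R)^-1 * \sum_(xi <- Gam N) ((chi^-1 * xi)%g \in Gam N)%:R) * 2^-1).
  apply/funext => N.
  rewrite -mulrDr -big_split /= -mulrA mulr_suml -(fejer_moment _ Gcompact mu_invariant).
  rewrite -[X in _ = X - _](fejer_int1 (Gam0 N) Gcompact mu_invariant) -haar_intB//.
  - by apply: eq_haar_int => x; rewrite mulrBr mulr1.
  - exact: fejer_continuous.
  - by apply: contM => //; exact: fejer_continuous.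
rewrite [X in _ --> X](_ : 0 = 1 - (1 + 1) * 2^-1 :> R); last by field.
apply: cvgB; first exact: cvg_cst.
by apply: cvgM; [apply: cvgD; exact: folner_moment|exact: cvg_cst].
Qed.

End Folner.

(** * Convergence of Fejer means in L^1 *)

Import HBSimple.

Section L1Density.
Context (R : realType) (G : topologicalZmodType) (mu : probability (borel G) R).
Hypothesis Gcompact : compact [set: G].
Hypothesis Gmetrizable : metrizable R G.
Implicit Types (f g : borel G -> R) (s : G -> R).
Local Notation intble f := (mu.-integrable setT (fun x : borel G => (f x)%:E)).

Definition approximable f := intble f /\ forall e, 0 < e ->
  exists2 s : G -> R, continuous s & \int[mu]_x `|f x - s x| <= e.

Lemma approximable_continuous s : continuous s -> approximable s.
Proof.
move=> cs; split=> [|e e0]; first exact: continuous_integrable.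
exists s => //; rewrite (_ : (fun x => _) = fun=> 0); last first.
  by apply/funext => x; rewrite subrr normr0.
by rewrite Rintegral_prob_cst ltW.
Qed.

Lemma approximable_limit f : intble f ->
  (forall e, 0 < e -> exists2 g, approximable g & \int[mu]_x `|f x - g x| <= e) ->
  approximable f.
Proof.
move=> fi fg; split=> // e e0; have e20 : 0 < e / 2 by rewrite divr_gt0.
have [g [gi /(_ _ e20)[s cs gs]] fge] := fg _ e20.
have si := continuous_integrable mu Gcompact cs.
exists s => //; rewrite [e]splitr; apply: le_trans (lerD fge gs).
have fgi : intble (fun x => `|f x - g x|) by exact/integrable_normR/integrable_subR.
have gsi : intble (fun x => `|g x - s x|) by exact/integrable_normR/integrable_subR.
rewrite -RintegralD//; apply: le_RintegralT.
- exact/integrable_normR/integrable_subR.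
- exact: integrable_addR.
- by move=> x; exact: ler_distD.
Qed.

Lemma approximableD f g : approximable f -> approximable g ->
  approximable (fun x => f x + g x).
Proof.
move=> [fi fa] [gi ga]; have fgi := integrable_addR fi gi; split=> // e e0.
have e20 : 0 < e / 2 by rewrite divr_gt0.
have [s cs fs] := fa _ e20; have [t ct gt] := ga _ e20.
exists (fun x => s x + t x); first exact: contD.
have si := continuous_integrable mu Gcompact cs.
have ti := continuous_integrable mu Gcompact ct.
have fsi : intble (fun x => `|f x - s x|) by exact/integrable_normR/integrable_subR.
have gti : intble (fun x => `|g x - t x|) by exact/integrable_normR/integrable_subR.
rewrite [e]splitr; apply: le_trans (lerD fs gt).
rewrite -RintegralD//; apply: le_RintegralT.
- by apply/integrable_normR/integrable_subR => //; exact: integrable_addR.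
- exact: integrable_addR.
- by move=> x; rewrite opprD addrACA; exact: ler_normD.
Qed.

Lemma approximableZ c f : approximable f -> approximable (fun x => c * f x).
Proof.
move=> [fi fa]; split=> [|e e0]; first exact: integrable_mulR.
have c1 : 0 < `|c| + 1 by rewrite ltr_pwDr.
have [s cs fs] := fa (e / (`|c| + 1)) (divr_gt0 e0 c1).
exists (fun x => c * s x); first exact: contZ.
have si := continuous_integrable mu Gcompact cs.
have fsi : intble (fun x => `|f x - s x|) by exact/integrable_normR/integrable_subR.
rewrite (_ : (fun x => _) = fun x => `|c| * `|f x - s x|); last first.
  by apply/funext => x; rewrite -mulrBr normrM.
rewrite RintegralZl//; move: fs; rewrite ler_pdivlMr// mulrC; apply: le_trans.
by rewrite ler_wpM2r ?lerDl// Rintegral_ge0.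
Qed.

Lemma approximable_bounded_limit (f_ : nat -> borel G -> R) f :
  (forall n, approximable (f_ n)) -> (forall n x, `|f_ n x| <= 1) ->
  (forall x, f_ ^~ x @ \oo --> f x) -> approximable f.
Proof.
move=> fa f1 fcv.
have mf n : measurable_fun setT (EFin \o f_ n).
  by apply: (measurable_int mu); exact: (fa n).1.
have efcv x : ((EFin \o f_ n) x @[n --> \oo] --> (EFin \o f) x)%E.
  by apply/fine_cvgP; split; [exact: nearW|exact: fcv].
have mlim : measurable_fun setT (EFin \o f).
  by apply: (emeasurable_fun_cvg _ _ mf) => x _; exact: efcv.
have f1' : \forall x \ae mu, forall n, setT x -> (`|(EFin \o f_ n) x| <= cst 1%:E x)%E.
  by apply: aeW => x n _ /=; rewrite lee_fin.
have i1 : mu.-integrable setT (cst 1%:E) by exact: finite_measure_integrable_cst.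
have [fi fl _] := dominated_convergence measurableT mf mlim
  (aeW _ (fun x _ => efcv x)) i1 f1'.
apply: approximable_limit => // e e0.
move/fine_cvgP : fl => [_ /cvgrPdist_le/(_ e e0)[N _ hN]].
exists (f_ N) => //; have := hN N (leqnn N).
rewrite /= sub0r normrN; apply: le_trans; rewrite ger0_norm ?fine_ge0 ?integral_ge0//.
rewrite le_eqVlt; apply/orP; left; apply/eqP; congr fine.
by apply: eq_integral => x _; rewrite /= distrC.
Qed.

Lemma approximable_lt0 s : continuous s -> approximable (\1_[set x | 0 < s x]).
Proof.
move=> cs.
(* Continuous functions with values in [[0, 1]]; at a point with [s x > 0] they are eventually 1, at
   the others constantly 0. *)
pose f_ n : borel G -> R := fun x => Num.min 1 (n%:R * Num.max 0 (s x)).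
apply: (@approximable_bounded_limit f_).
- move=> n.
  have cn : continuous (fun x : G => n%:R * Num.max 0 (s x)).
    apply: contZ => x.
    by apply (@continuous_max R G (fun=> 0) s x); [exact: cvg_cst|exact: cs].
  apply: (@approximable_continuous (fun x => Num.min 1 (n%:R * Num.max 0 (s x)))) => x.
  by apply (@continuous_min R G (fun=> 1) _ x); [exact: cvg_cst|exact: cn].
- move=> n x; rewrite /f_ ger0_norm ?ge_min ?lexx//.
  by rewrite le_min ler01 mulr_ge0// le_max lexx.
- move=> x; rewrite indicE; have [sx|sx] := ltrP 0 (s x).
    rewrite mem_set//; apply: cvg_near_cst; exists (Num.truncn (s x)^-1).+1 => // n /= hn.
    rewrite /f_ (max_idPr (ltW sx)); apply/min_idPl.
    rewrite -ler_pdivrMr// div1r; apply: ltW; apply: lt_le_trans (truncnS_gt _) _.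
    by rewrite ler_nat.
  rewrite memNset/=; last by apply/negP; rewrite -leNgt.
  by apply: cvg_near_cst; apply: nearW => n; rewrite /f_ max_l// mulr0 min_r.
Qed.

(** [s] is the distance to the complement. The whole group is treated apart, since its complement
    gives an empty infimum. *)
Lemma open_positive_set (U : set G) : open U ->
  exists2 s : G -> R, continuous s & U = [set x | 0 < s x].
Proof.
move=> oU; have [[y0 Uy0]|UT] := pselect (exists y, ~ U y); last first.
  exists (fun=> 1); first exact: cst_continuous.
  apply/seteqP; split => x //= _; apply: contrapT => Ux; apply: UT; by exists x.
have [d [d0 dC dT dnbhs]] := Gmetrizable.
have dge0 x y : 0 <= d x y.
  have := dT x y x; rewrite (dC y x) (d0 x x).2//; lra.
pose D x := [set d x y | y in ~` U].
have Dinf x : has_inf (D x).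
  by split; [exists (d x y0), y0|exists 0 => _ [y _ <-]].
pose s x := inf (D x).
have sle x y : s x <= d x y + s y.
  rewrite addrC -lerBlDr; apply: lb_le_inf; first by case: (Dinf y).
  move=> _ [z Uz <-]; rewrite lerBlDr addrC; apply: le_trans (dT x y z).
  by apply: ge_inf; [case: (Dinf x)|exists z].
exists s.
  move=> x; apply/cvgrPdist_lt => e e0; have : nbhs x [set b | d x b < e].
    by rewrite dnbhs; exists e.
  apply: filterS => y /= xy.
  by have := sle x y; have := sle y x; rewrite (dC y x) ltr_norml; lra.
apply/seteqP; split => x /=.
  move=> Ux; have : nbhs x U by move: oU; rewrite openE => /(_ x Ux).
  rewrite dnbhs => -[e /= e0 eU]; apply: (lt_le_trans e0).
  apply: lb_le_inf; first by case: (Dinf x).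
  by move=> _ [z Uz <-]; rewrite leNgt; apply/negP => /eU.
move=> sx; apply: contrapT => Ux; move: sx; apply/negP; rewrite -leNgt.
by apply: ge_inf; [case: (Dinf x)|exists x => //; exact/d0].
Qed.

(** Dynkin induction from the open sets: complements are handled by linearity, countable disjoint
    unions as bounded pointwise limits of finite sums. *)
Lemma approximable_indic (A : set (borel G)) : measurable A -> approximable (\1_A).
Proof.
apply: (@dynkin_induction _ (borel G) (@open G) (fun A => approximable (\1_A))) => //.
- by move=> U V; exact: openI.
- by rewrite indicT; apply: approximable_continuous; exact: cst_continuous.
- by move=> U /open_positive_set[s cs ->]; exact: approximable_lt0.
- move=> S mS aS; have -> : \1_(~` S) = (fun x => 1 + -1 * \1_S x) :> (borel G -> R).
    by apply/funext => x; rewrite !indicE in_setC mulN1r; case: (x \in S); rewrite ?subr0 ?subrr.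
  apply: approximableD; last exact: approximableZ.
  by apply: approximable_continuous; exact: cst_continuous.
move=> F mF tF aF.
pose f_ n : borel G -> R := \1_(\bigcup_(i < n) F i).
apply: (@approximable_bounded_limit f_).
- elim=> [|n IHn].
    rewrite /f_ bigcup_mkord big_ord0 indic0.
    by apply: approximable_continuous; exact: cst_continuous.
  rewrite /f_ bigcup_mkord big_ord_recr/= -bigcup_mkord.
  have -> : \1_(\bigcup_(i < n) F i `|` F n) = (fun x => f_ n x + \1_(F n) x) :> (borel G -> R).
    apply/funext => x; rewrite /f_ !indicE in_setU.
    case: (boolP (x \in \bigcup_(i < n) F i)) => /= [|_]; last by rewrite add0r.
    move=> /set_mem[i /= ni Fi]; rewrite memNset ?addr0// => Fn.
    by have E := tF i n Logic.I Logic.I (ex_intro _ x (conj Fi Fn)); rewrite E ltnn in ni.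
  exact: approximableD.
- by move=> n x; rewrite /f_ indicE ger0_norm ?ler0n// lern1 leq_b1.
- move=> x; rewrite indicE; have [Fx|Fx] := pselect ((\bigcup_k F k) x).
    rewrite mem_set//; have [i _ Fi] := Fx.
    apply: cvg_near_cst; exists i.+1 => // n /= hn; rewrite /f_ indicE mem_set//.
    by exists i.
  rewrite memNset//; apply: cvg_near_cst; apply: nearW => n.
  rewrite /f_ indicE memNset// => -[i _ Fi].
  by apply: Fx; exists i.
Qed.

Lemma approximable_integrable f : intble f -> approximable f.
Proof.
move=> fi; have [g_ [gi _ gf]] := approximation_sfun_integrable measurableT fi.
apply: approximable_limit => // e e0.
move/fine_cvgP : gf => [_ /cvgrPdist_le/(_ e e0)[N _ hN]].
exists (fun x => g_ N x); last first.
  by have := hN N (leqnn N); rewrite /= sub0r normrN; apply: le_trans; exact: ler_norm.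
rewrite (_ : (fun x => g_ N x) = fun x => \sum_(y <- fset_set (range (g_ N)))
    (y * \1_(g_ N @^-1` [set y]) x)); last first.
  by apply/funext => x; rewrite fimfunE fsbig_finite.
elim: (enum_fset _) => [|y r IHr].
  under eq_fun do rewrite big_nil.
  by apply: approximable_continuous; exact: cst_continuous.
under eq_fun do rewrite big_cons.
apply: approximableD => //; apply: approximableZ; apply: approximable_indic.
exact: measurable_funPTI.
Qed.

End L1Density.

(** * Fejer kernels as an approximate identity *)

Section FejerConvergence.
Context (R : realType) (G : topologicalZmodType) (mu : probability (borel G) R).
Hypothesis Gcompact : compact [set: G].
Hypothesis Gmetrizable : metrizable R G.
Hypothesis mu_invariant : haar_invariant mu.
Local Notation Re := complex.Re.
Local Notation I := (haar_int mu).
Local Notation intble f := (mu.-integrable setT (fun x : borel G => (f x)%:E)).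

(* Characters separate points, so finitely many of the functions [1 - Re chi] dominate *)
(* the oscillation of [s] away from 0.                                                 *)
Lemma oscillation_bound (s : G -> R) (e : R) : continuous s -> 0 < e ->
  exists J : seq (R * dual R G), forall x y,
    `|s (x - y) - s x| <= e + \sum_(p <- J) p.1 * (1 - Re (p.2 y)).
Proof.
move=> cs e0; have [M M0 sM] := continuous_bounded Gcompact cs.
(* The local form of the bound: [t] collects a coefficient, a character and a neighbourhood of [y].
   Around 0 uniform continuity suffices and the coefficient is 0. *)
have loc y : exists t : R * dual R G * set G, [/\ 0 <= t.1.1, open t.2, t.2 y &
    forall x y', t.2 y' -> `|s (x - y') - s x| <= e + t.1.1 * (1 - Re (t.1.2 y'))].
  have [->|y0] := eqVneq y 0.
    have : \forall y' \near (0 : G), [set: G] `<=` [set x | `|s (x - y') - s x| <= e].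
      move/compact_near_coveringP : Gcompact; apply => x _.
      have c1 : continuous (fun z : G * G => s (z.1 - z.2) - s z.1).
        by apply: contB; apply: cont_comp => //; cont.
      have /cvgrPdist_le/(_ e e0) := c1 (x, 0).
      by rewrite /= subr0 subrr; apply: filterS => z /=; rewrite sub0r normrN.
    rewrite /= => /nbhs_interior nO.
    exists (0, 1%g, [set y' | [set: G] `<=` [set x | `|s (x - y') - s x| <= e]]°) => /=.
    split=> //; first exact: open_interior.
      exact: nbhs_singleton nO.
    by move=> x y' /interior_subset/= /(_ x Logic.I); rewrite mul0r addr0.
  have [chi chiy] := characters_separate Gcompact Gmetrizable mu_invariant y0.
  have d0 : 0 < 1 - Re (chi y) by rewrite subr_gt0.
  (* The oscillation of [s] never exceeds [2 * M]; this [c] makes [c * (1 - Re chi)] equal to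
     [2 * M + 1] at [y], hence larger than [2 * M] nearby. *)
  pose c := (2 * M + 1) / (1 - Re (chi y)).
  have c0 : 0 <= c by rewrite divr_ge0 ?ltW//; lra.
  have cc : continuous (fun y' => c * (1 - Re (chi y'))).
    by apply: contZ; apply: contB; [exact: cst_continuous|exact: dual_Re_continuous].
  exists (c, chi, [set y' | 2 * M < c * (1 - Re (chi y'))]) => /=; split=> //.
  - apply: (@open_comp _ _ (fun y' => c * (1 - Re (chi y'))) [set z | 2 * M < z]).
      by move=> z _; exact: cc.
    exact: open_gt.
  - by rewrite divfK ?gt_eqF//; lra.
  - move=> x y' hy'; have := sM (x - y'); have := sM x; have := ler_normB (s (x - y')) (s x).
    lra.
have [f hf] := choice loc.
have [D _ hD] : finite_subset_cover [set: G] (fun y => (f y).2) [set: G].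
  apply: (compact_cover_zmod Gcompact) => [y _|y _]; first by have [] := hf y.
  by exists y => //; have [] := hf y.
exists [seq (f y).1 | y <- D] => x y; have [a /= aD ya] := hD y Logic.I.
have [_ _ _ /(_ x y ya) h] := hf a; apply: le_trans h _; rewrite lerD2l big_map.
rewrite (big_rem a)//= lerDl sumr_ge0// => b _; rewrite mulr_ge0//; first by have [] := hf b.
by rewrite subr_ge0 dual_Re_le1.
Qed.

Implicit Types (F : G -> R) (tau : borel G -> R).

(** Unlike [conv], meant for a [tau] that is only integrable; the continuous factor is the one that
    is translated. *)
Definition convL1 (F : G -> R) (tau : borel G -> R) (x : G) : R :=
  \int[mu]_y (F (x - y) * tau y).

Lemma integrable_bounded_mul (h tau : borel G -> R) M : measurable_fun setT h ->
  (forall y, `|h y| <= M) -> intble tau -> intble (fun y => h y * tau y).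
Proof.
move=> mh hM ti.
have hb : [bounded h y | y in setT].
  by exists M; split; [exact: num_real|move=> N MN x _ /=; exact: le_trans (hM x) (ltW MN)].
rewrite (_ : (fun y => _) = (fun y => (tau y)%:E * (h y)%:E)%E).
  exact: (integrableMl measurableT ti mh hb).
by apply/funext => y; rewrite -EFinM mulrC.
Qed.

Lemma integrable_convL1_slice F tau x : continuous F -> intble tau ->
  intble (fun y => F (x - y) * tau y).
Proof.
move=> cF ti; have [M M0 FM] := continuous_bounded Gcompact cF.
apply: (@integrable_bounded_mul (fun y => F (x - y)) tau M) => //.
by apply: continuous_borel_measurable; apply: cont_comp => //; cont.
Qed.

Lemma integrable_convL1_prod F tau : continuous F -> intble tau ->
  (mu \x mu)%E.-integrable setT (fun z : borel G * borel G => (F (z.1 - z.2) * tau z.2)%:E).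
Proof.
move=> cF ti; have [M M0 FM] := continuous_bounded Gcompact cF.
have mt : measurable_fun setT (fun z : borel G * borel G => (tau z.2)%:E).
  apply: (measurableT_comp (f := EFin \o tau)) => //.
  exact: (measurable_int mu).
have ti2 : (mu \x mu)%E.-integrable setT (fun z : borel G * borel G => (tau z.2)%:E).
  apply/integrable12ltyP => //=; have [_ tf] := integrableP _ _ _ ti.
  rewrite integral_cst//= probability_setT mule1.
  exact: tf.
have mF : measurable_fun setT (fun z : borel G * borel G => F (z.1 - z.2)).
  apply: (@continuous_prod_measurable R G Gcompact Gmetrizable (fun z => F (z.1 - z.2))).
  by apply: cont_comp => //; cont.
have Fb : [bounded F (z.1 - z.2) | z in (setT : set (borel G * borel G))].
  by exists M; split; [exact: num_real|move=> N MN z _ /=; exact: le_trans (FM _) (ltW MN)].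
rewrite (_ : (fun z => _) = (fun z => (tau z.2)%:E * (F (z.1 - z.2))%:E)%E).
  exact: (integrableMl measurableT ti2 mF Fb).
by apply/funext => z; rewrite -EFinM mulrC.
Qed.

Lemma EFin_convL1 F tau x : continuous F -> intble tau ->
  (convL1 F tau x)%:E = (\int[mu]_y (F (x - y) * tau y)%:E)%E.
Proof.
move=> cF ti; rewrite /convL1 /Rintegral fineK//.
by apply: integrable_fin_num => //; exact: integrable_convL1_slice.
Qed.

Lemma integrable_convL1 F tau : continuous F -> intble tau -> intble (convL1 F tau).
Proof.
move=> cF ti; have := integrable_fubini_F (integrable_convL1_prod cF ti).
by rewrite (_ : (fun x => _) = fubini_F mu
    (fun z : borel G * borel G => (F (z.1 - z.2) * tau z.2)%:E));
  last by apply/funext => x; rewrite EFin_convL1.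
Qed.

Lemma int_convL1 F tau : continuous F -> I F = 1 -> intble tau ->
  \int[mu]_x convL1 F tau x = \int[mu]_x tau x.
Proof.
move=> cF F1 ti; rewrite /Rintegral; congr fine.
under eq_integral do rewrite EFin_convL1//.
rewrite (Fubini (integrable_convL1_prod cF ti)) /=.
apply: eq_integral => y _; under eq_integral do rewrite EFinM muleC.
have cFy : continuous (fun x => F (x - y)) by apply: cont_comp => //; cont.
have iF := continuous_integrable mu Gcompact cFy.
rewrite integralZl// -[RHS]mule1; congr (_ * _)%E.
have -> : 1%E = (I (fun x => F (x - y)))%:E.
  by rewrite (haar_int_translater Gcompact mu_invariant (- y) cF) F1.
by rewrite /haar_int /Rintegral fineK//; exact: integrable_fin_num.
Qed.

(** The bound does not depend on the kernel, so an approximation error in [sigma] passes through all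
    Fejer means at once. *)
Lemma convL1_contraction F tau : continuous F -> (forall x, 0 <= F x) -> I F = 1 ->
  intble tau -> \int[mu]_x `|convL1 F tau x| <= \int[mu]_x `|tau x|.
Proof.
move=> cF F0 F1 ti; have ta := integrable_normR ti.
rewrite -(int_convL1 cF F1 ta); apply: le_RintegralT.
- exact/integrable_normR/integrable_convL1.
- exact: integrable_convL1.
move=> x; have ts := integrable_convL1_slice x cF ti.
apply: le_trans (le_normr_Rintegral measurableT ts) _.
rewrite le_eqVlt; apply/orP; left; apply/eqP; apply: eq_Rintegral => y _.
by rewrite normrM ger0_norm.
Qed.

Variable Gam : nat -> {fset dual R G}.
Hypothesis Gam0 : forall N, Gam N != fset0.
Hypothesis folner : forall eta : dual R G,
    let etaGam N := [fset (eta * xi)%g | xi in Gam N]%fset in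
    (fun N => #|` (etaGam N `\` Gam N) `|` (Gam N `\` etaGam N)|%fset%:R
              / #|` Gam N|%:R : R) @ \oo --> (0 : R).

(** As the kernel has integral 1, the difference is the mean of [s (x - y) - s x] in [y].
    [oscillation_bound] dominates it by [e / 2] plus finitely many moments that tend to 0,
    independently of [x]. *)
Lemma fejer_uniform (s : G -> R) (e : R) : continuous s -> 0 < e ->
  \forall N \near \oo, forall x, `|conv mu (fejer (Gam N)) s x - s x| <= e.
Proof.
move=> cs e0; have e20 : 0 < e / 2 by rewrite divr_gt0.
have [J hJ] := oscillation_bound cs e20.
have cJ (p : R * dual R G) : continuous (fun y => 1 - Re (p.2 y)).
  by apply: contB; [exact: cst_continuous|exact: dual_Re_continuous].
have cF N : continuous (fejer (Gam N)) by exact: fejer_continuous.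
have lim0 : (fun N => \sum_(p <- J) p.1 * I (fun y => fejer (Gam N) y * (1 - Re (p.2 y))))
    @ \oo --> (0 : R).
  elim: J {hJ} => [|p J IHJ].
    by under eq_fun do rewrite big_nil; exact: cvg_cst.
  under eq_fun do rewrite big_cons.
  have hp : (fun N => I (fun y => fejer (Gam N) y * (1 - Re (p.2 y)))) @ \oo --> (0 : R).
    exact: fejer_moment_cvg.
  have := cvgD (cvgM (cvg_cst p.1) hp) IHJ; rewrite mulr0 addr0; exact.
have /cvgrPdist_le/(_ _ e20) := lim0; apply: filterS => N hN x.
have c1 : continuous (fun y => fejer (Gam N) y * s (x - y)) by exact: cont_conv1.
have c2 : continuous (fun y => fejer (Gam N) y * s x).
  by apply: contM => //; exact: cst_continuous.
have -> : conv mu (fejer (Gam N)) s x - s x =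
    I (fun y => fejer (Gam N) y * s (x - y) - fejer (Gam N) y * s x).
  rewrite haar_intB//; congr (_ - _).
  rewrite -[LHS]mulr1 -(fejer_int1 (Gam0 N) Gcompact mu_invariant) -haar_intZ//.
  by apply: eq_haar_int => y; rewrite mulrC.
have c3 : continuous (fun y => fejer (Gam N) y * (e / 2) +
    \sum_(p <- J) p.1 * (fejer (Gam N) y * (1 - Re (p.2 y)))).
  apply: contD; first by apply: contM => //; exact: cst_continuous.
  by apply: continuous_sum => p; apply: contZ; exact: contM.
have c4 : continuous (fun y => fejer (Gam N) y * s (x - y) - fejer (Gam N) y * s x).
  exact: contB.
have hle y : `|fejer (Gam N) y * s (x - y) - fejer (Gam N) y * s x| <=
    fejer (Gam N) y * (e / 2) + \sum_(p <- J) p.1 * (fejer (Gam N) y * (1 - Re (p.2 y))).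
  rewrite -mulrBr normrM ger0_norm ?fejer_ge0//.
  apply: le_trans (ler_wpM2l (fejer_ge0 _ _) (hJ x y)) _.
  rewrite mulrDr lerD2l mulr_sumr le_eqVlt; apply/orP; left; apply/eqP.
  by apply: eq_bigr => p _; rewrite mulrCA.
have hI : I (fun y => fejer (Gam N) y * (e / 2) +
    \sum_(p <- J) p.1 * (fejer (Gam N) y * (1 - Re (p.2 y)))) <= e.
  rewrite haar_intD//; first last.
  - by apply: continuous_sum => p; apply: contZ; exact: contM.
  - by apply: contM => //; exact: cst_continuous.
  rewrite haar_int_sum//; last by move=> p; apply: contZ; exact: contM.
  rewrite [X in _ + X](_ : _ = \sum_(p <- J) p.1 *
      I (fun y => fejer (Gam N) y * (1 - Re (p.2 y)))); last first.
    by apply: eq_bigr => p _; rewrite haar_intZ//; exact: contM.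
  rewrite (_ : I _ = e / 2); last first.
    rewrite -[RHS]mulr1 -(fejer_int1 (Gam0 N) Gcompact mu_invariant) -haar_intZ//.
    by apply: eq_haar_int => y; rewrite mulrC.
  move: hN; rewrite sub0r normrN => /(le_trans (ler_norm _)); lra.
rewrite ler_norml; apply/andP; split.
  rewrite -[leLHS]mulN1r; apply: le_trans (_ : -1 * I (fun y => fejer (Gam N) y * (e / 2) +
    \sum_(p <- J) p.1 * (fejer (Gam N) y * (1 - Re (p.2 y)))) <= _); first by lra.
  rewrite -haar_intZ//; apply: le_haar_int => //; first exact: contZ.
  by move=> y; have := hle y; rewrite ler_norml mulN1r => /andP[].
apply: le_trans hI; apply: le_haar_int => // y.
by have := hle y; rewrite ler_norml => /andP[].
Qed.

Lemma fejer_L1 (sigma : borel G -> R) (e : R) : intble sigma -> 0 < e ->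
  \forall N \near \oo, \int[mu]_x `|convL1 (fejer (Gam N)) sigma x - sigma x| <= e.
Proof.
move=> si e0; have e30 : 0 < e / 3 by rewrite divr_gt0.
have [_ /(_ _ e30)[s cs ss]] := approximable_integrable Gcompact Gmetrizable si.
have sc := continuous_integrable mu Gcompact cs.
have ti : intble (fun x => sigma x - s x) by exact: integrable_subR.
apply: filterS (fejer_uniform cs e30) => N hN.
have cF : continuous (fejer (Gam N)) by exact: fejer_continuous.
have F1 := fejer_int1 (Gam0 N) Gcompact mu_invariant.
have split3 x : `|convL1 (fejer (Gam N)) sigma x - sigma x| <=
    `|convL1 (fejer (Gam N)) (fun x => sigma x - s x) x| + (e / 3 + `|sigma x - s x|).
  have -> : convL1 (fejer (Gam N)) sigma x =
      convL1 (fejer (Gam N)) (fun x => sigma x - s x) x + conv mu (fejer (Gam N)) s x.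
    rewrite (convC Gcompact Gmetrizable mu_invariant cF cs) /convL1 /conv /haar_int.
    rewrite -RintegralD//; last 2 first.
    - exact: integrable_convL1_slice.
    - by apply: continuous_integrable => //; exact: cont_conv1.
    by apply: eq_Rintegral => y _; rewrite mulrBr (mulrC (s y)) subrK.
  rewrite -addrA; apply: le_trans (ler_normD _ _) _; rewrite lerD2l.
  rewrite -(subrKA (s x)); apply: le_trans (ler_normD _ _) _.
  by rewrite (distrC (s x)) lerD.
have h1 := convL1_contraction cF (@fejer_ge0 _ _ (Gam N)) F1 ti.
have i1 := integrable_normR (integrable_convL1 cF ti).
have i2 := integrable_normR ti.
have i3 : intble (fun x => e / 3 + `|sigma x - s x|).
  by apply: integrable_addR => //; exact: finite_measure_integrable_cst.
have : \int[mu]_x `|convL1 (fejer (Gam N)) sigma x - sigma x| <=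
    \int[mu]_x (`|convL1 (fejer (Gam N)) (fun x => sigma x - s x) x| +
      (e / 3 + `|sigma x - s x|)).
  apply: le_RintegralT => [||x]; last exact: split3.
    by apply/integrable_normR/integrable_subR => //; exact: integrable_convL1.
  exact: integrable_addR.
rewrite RintegralD// RintegralD//; last exact: finite_measure_integrable_cst.
rewrite Rintegral_prob_cst; lra.
Qed.

End FejerConvergence.

(** * The spectrum of the Toeplitz matrix *)

Section EigenBasis.
Context (R : realType) (V : vectType R[i]) (n : nat) (T : 'End(V)).
Variables (e : 'I_n -> V) (l : 'I_n -> R[i]).
Hypothesis e_basis : basis_of fullv [tuple e j | j < n].
Hypothesis Te : forall j, T (e j) = l j *: e j.

Let X := [tuple e j | j < n].
Let XE (i : 'I_n) : X`_i = e i.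
Proof. by rewrite -tnth_nth tnth_mktuple. Qed.

Lemma leigenspace_basis lam :
  passmx.leigenspace T lam = <<[seq e j | j <- enum 'I_n & l j == lam]>>%VS.
Proof.
apply/eqP; rewrite eqEsubv; apply/andP; split; last first.
  apply/span_subvP => _ /mapP[j + ->]; rewrite mem_filter => /andP[/eqP <- _].
  by rewrite memv_ker add_lfunE opp_lfunE scale_lfunE id_lfunE Te subrr.
apply/subvP => v; rewrite memv_ker add_lfunE opp_lfunE scale_lfunE id_lfunE => /eqP.
have vX : v \in <<X>>%VS by rewrite (span_basis e_basis) memvf.
have vE := coord_span vX; set c := coord X in vE *.
move=> Tv0; have cl : \sum_(i < n) (c i v * (l i - lam)) *: X`_i = 0.
  rewrite -[RHS]Tv0 {2 3}vE linear_sum scaler_sumr -sumrB; apply: eq_bigr => i _.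
  by rewrite linearZ /= XE Te !scalerA -scalerBl mulrBr (mulrC lam).
have /freeP/(_ _ cl) c0 := basis_free e_basis.
rewrite vE rpred_sum// => i _; rewrite XE.
have [li|li] := eqVneq (l i) lam.
  by rewrite memvZ// memv_span// map_f// mem_filter li eqxx mem_enum.
have /eqP := c0 i; rewrite mulf_eq0 subr_eq0 (negbTE li) orbF => /eqP ->.
by rewrite scale0r mem0v.
Qed.

Lemma dim_leigenspace lam :
  \dim (passmx.leigenspace T lam) = count_mem lam [seq l j | j <- enum 'I_n].
Proof.
rewrite leigenspace_basis.
set Y := [seq e j | j <- _].
have /eqP -> : free Y.
  have := basis_free e_basis.
  have /perm_free -> : perm_eq X (Y ++ [seq e j | j <- enum 'I_n & l j != lam]).
    by rewrite -map_cat /= perm_map// perm_sym perm_filterC.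
  exact: catl_free.
by rewrite size_map size_filter [RHS]count_map.
Qed.

(** The dimension of an eigenspace is the number of occurrences of its eigenvalue in [l], so the sum
    over distinct eigenvalues regroups into one over the basis. *)
Lemma tr_log_eigenbasis : tr_log T = (\sum_(j < n) lne (complex.Re (l j))%:E)%E.
Proof.
pose r := [seq l j | j <- enum 'I_n].
have eigE : [set lam | passmx.leigenvalue T lam] = [set` undup r].
  apply/seteqP; split => lam /=; rewrite /passmx.leigenvalue -dimv_eq0 dim_leigenspace
    mem_undup -lt0n -has_count has_pred1 //.
rewrite /tr_log eigE -fsbig_seq ?undup_uniq//.
rewrite [RHS](_ : _ = (\sum_(lam <- r) lne (complex.Re lam)%:E)%E); last first.
  by rewrite big_map big_enum.
rewrite -[RHS]big_undup_iterop_count; apply: eq_bigr => lam _.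
by rewrite dim_leigenspace mule_natl.
Qed.

End EigenBasis.

(** * Diagonalization of the Toeplitz operator and the eigenvector densities *)

Section ToeplitzSpectral.
Context (R : realType) (G : topologicalZmodType) (mu : probability (borel G) R).
Hypothesis Gcompact : compact [set: G].
Hypothesis mu_invariant : haar_invariant mu.
Variable Gam : {fset dual R G}.
Hypothesis Gam0 : Gam != fset0.
Local Notation intble f := (mu.-integrable setT (fun x : borel G => (f x)%:E)).
Local Notation C := R[i].
Local Notation n := (size (enum_fset Gam)).

Let conjM (a b : C) : (a * b)^* = a^* * b^*. Proof. exact: rmorphM. Qed.

Let conj_sum m (F : 'I_m -> C) : (\sum_i F i)^* = \sum_i (F i)^*.
Proof. exact: rmorph_sum. Qed.

Let realM (a b : R) : (a * b)%:C%C = a%:C%C * b%:C%C :> C.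
Proof. exact: rmorphM. Qed.

Let real_sum m (F : 'I_m -> R) : (\sum_i F i)%:C%C = \sum_i (F i)%:C%C :> C.
Proof. exact: rmorph_sum. Qed.

Let real_nat m : (m%:R)%:C%C = m%:R :> C.
Proof. exact: rmorph_nat. Qed.

Let conj_real (a : R) : (a%:C%C)^* = a%:C%C :> C.
Proof. by apply/eqP; rewrite eq_complex /= oppr0 !eqxx. Qed.

Lemma cintegral_real (f : G -> R) : cintegral mu (fun x => (f x)%:C%C) = (\int[mu]_x f x)%:C%C.
Proof. by rewrite /cintegral /= Rintegral_prob_cst. Qed.

Lemma cintegral_conj (f : G -> C) : cintegrable mu f ->
  cintegral mu (fun x => (f x)^*) = (cintegral mu f)^*.
Proof.
move=> [fr fi]; rewrite /cintegral /=.
have -> : \int[mu]_x complex.Re (f x)^* = \int[mu]_x complex.Re (f x).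
  by apply: eq_Rintegral => x _; case: (f x).
have -> : \int[mu]_x complex.Im (f x)^* = - \int[mu]_x complex.Im (f x).
  rewrite -mulN1r -RintegralZl//; apply: eq_Rintegral => x _.
  by case: (f x) => a b /=; rewrite mulN1r.
by [].
Qed.

Lemma cintegral_sum (J : Type) (r : seq J) (F : J -> G -> C) :
  (forall j, cintegrable mu (F j)) ->
  cintegrable mu (fun x => \sum_(j <- r) F j x) /\
  cintegral mu (fun x => \sum_(j <- r) F j x) = \sum_(j <- r) cintegral mu (F j).
Proof.
move=> Fi; elim: r => [|j r [IHi IHe]].
  under eq_fun do rewrite big_nil.
  rewrite big_nil; split; first exact: cint0.
  by rewrite /cintegral /= !Rintegral_prob_cst.
under eq_fun do rewrite big_cons.
have [h1 h2] := cintD (Fi j) IHi.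
by split; [exact: h1|rewrite big_cons h2 IHe].
Qed.

Definition xi_ (i : 'I_n) : dual R G := tnth (in_tuple Gam) i.

Lemma xi_inj : injective xi_.
Proof. exact/tuple_uniqP/fset_uniq. Qed.

(** The matrix of the Toeplitz operator in the basis [Gam]. The symbol stays a parameter because the
    constant symbol 1 gives the Gram matrix of the characters. *)
Definition fourier_mx (sigma : borel G -> R) : 'M[C]_n :=
  \matrix_(i, k) cintegral mu (fun x => (sigma x)%:C%C * (xi_ k * (xi_ i)^-1)%g x).

Lemma fourier_mx1 : fourier_mx (fun=> 1) = 1%:M.
Proof.
apply/matrixP => i k; rewrite !mxE.
under [X in cintegral _ X]funext => x do rewrite mul1r.
by rewrite (cint_char Gcompact mu_invariant) -[X in X == _]mulg1 mulg_eq1_solve mul1g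
  (inj_eq xi_inj).
Qed.

Lemma fourier_mx_herm sigma : intble sigma -> fourier_mx sigma \is hermsymmx.
Proof.
move=> si; rewrite is_hermitianmxE expr0 scale1r; apply/eqP/matrixP => i k; rewrite !mxE.
rewrite -cintegral_conj; last exact: cint_dual.
congr (cintegral _ _); apply/funext => x; rewrite conjM conj_real dual_conj invgM invgK.
by [].
Qed.

Let basis_elt (k : 'I_n) : kspace Gam := comb Gam (fun xi => (xi == xi_ k)%:R).

Let basis_eltE k x : kval (basis_elt k) x = xi_ k x.
Proof.
rewrite /= char_combE (big_tnth _ _ Gam) (bigD1 k)//= eqxx mul1r big1 ?addr0// => i ik.
by rewrite (inj_eq xi_inj) (negbTE ik) mul0r.
Qed.

Let kval_sum (f : 'I_n -> kspace Gam) x : kval (\sum_i f i) x = \sum_i kval (f i) x.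
Proof.
rewrite -[kval _]/(val _) raddf_sum fct_sumE.
by [].
Qed.

Let kval_scale c (f : kspace Gam) x : kval (c *: f) x = c * kval f x.
Proof. by []. Qed.

Lemma toeplitz_basis sigma k : intble sigma ->
  toeplitz mu Gam sigma (basis_elt k) = \sum_i fourier_mx sigma i k *: basis_elt i.
Proof.
move=> si; rewrite toeplitzE//; apply: val_inj; apply/funext => x.
rewrite -[LHS]/(char_comb Gam _ x) char_combE [RHS]kval_sum (big_tnth _ _ Gam).
apply: eq_bigr => i _; rewrite kval_scale basis_eltE !mxE; congr (cintegral _ _ * _).
by apply/funext => y; rewrite basis_eltE dual_conj -mulrA.
Qed.

Variable sigma : borel G -> R.
Hypothesis sigma_int : intble sigma.

Let A := fourier_mx sigma.
Let U := spectralmx A.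
Let lam j := spectral_diag A 0 j.
Local Notation Ut := (U ^t* )%sesqui.

Let UUt : U *m Ut = 1%:M.
Proof. exact/unitarymxP/spectral_unitarymx. Qed.

Let UtU : Ut *m U = 1%:M.
Proof. exact: mulmx1C UUt. Qed.

Let AE : A = Ut *m diag_mx (spectral_diag A) *m U.
Proof.
rewrite -invmx_unitary ?spectral_unitarymx//.
exact/orthomx_spectralP/hermitian_normalmx/fourier_mx_herm.
Qed.

Let Aik i k : A i k = \sum_j (U j i)^* * lam j * U j k.
Proof.
rewrite {1}AE -mulmxA !mxE; apply: eq_bigr => j _.
by rewrite mul_diag_mx !mxE mulrA.
Qed.

(** Since [A = Ut *m D *m U] with [D] diagonal, the eigenvectors are the columns of [Ut], whence the
    conjugate. *)
Let e j : kspace Gam := \sum_k (U j k)^* *: basis_elt k.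

Let UUtE j : \sum_i U j i * (U j i)^* = 1.
Proof.
have /matrixP/(_ j j) := UUt; rewrite !mxE eqxx => h; rewrite -[RHS]h.
by apply: eq_bigr => i _; rewrite !mxE.
Qed.

Let UtUE i k : \sum_j U j i * (U j k)^* = (i == k)%:R.
Proof.
have /matrixP/(_ k i) := UtU; rewrite !mxE eq_sym => <-.
by apply: eq_bigr => j _; rewrite !mxE mulrC.
Qed.

Let basis_eltU i : basis_elt i = \sum_j U j i *: e j.
Proof.
under eq_bigr do rewrite scaler_sumr.
rewrite exchange_big /= (bigD1 i)//= [X in _ + X]big1 ?addr0 => [|k ki].
  by under eq_bigr do rewrite scalerA; rewrite -scaler_suml UtUE eqxx scale1r.
under eq_bigr do rewrite scalerA; rewrite -scaler_suml UtUE.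
by rewrite eq_sym (negbTE ki) scale0r.
Qed.

Let Te j : toeplitz mu Gam sigma (e j) = lam j *: e j.
Proof.
rewrite /e linear_sum scaler_sumr.
under eq_bigr do rewrite linearZ /= toeplitz_basis// scaler_sumr.
rewrite exchange_big /=; apply: eq_bigr => i _.
under eq_bigr do rewrite scalerA; rewrite -scaler_suml scalerA; congr (_ *: _).
have : (A *m Ut) i j = ((Ut *m diag_mx (spectral_diag A))) i j.
  congr (fun_of_matrix _ i j). rewrite [LHS](congr1 (mulmx^~ Ut) AE). 
  by rewrite -[LHS]mulmxA UUt mulmx1.
rewrite mul_mx_diag !mxE mulrC => <-.
by apply: eq_bigr => k _; rewrite !mxE mulrC.
Qed.

Let e_basis : basis_of fullv [tuple e j | j < n].
Proof.
rewrite basisEdim size_tuple dimvf leqnn andbT; apply/subvP => f _.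
have -> : f = \sum_i span_coef f (xi_ i) *: basis_elt i.
  apply: val_inj; apply/funext => x; rewrite [RHS]kval_sum -[LHS]/(kval f x) {1}span_coefE.
  rewrite char_combE (big_tnth _ _ Gam); apply: eq_bigr => i _.
  by rewrite kval_scale basis_eltE.
rewrite rpred_sum// => i _; rewrite memvZ// basis_eltU rpred_sum// => j _; rewrite memvZ//.
by rewrite memv_span//; apply/mapP; exists j; rewrite ?mem_enum.
Qed.

Let E j x : C := \sum_k (U j k)^* * xi_ k x.

(** The density [|e_j|^2], taken as a real number; [wE] shows that no imaginary part is lost. *)
Definition eigen_weight j x : R := complex.Re (E j x * (E j x)^*).
Local Notation w := eigen_weight.

Let wE j x : (w j x)%:C%C = E j x * (E j x)^*.
Proof.
have : 0 <= E j x * (E j x)^* by rewrite mul_conjC_ge0.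
by rewrite /w; case: (E j x * _) => a b; rewrite lecE /= => /andP[/eqP ->].
Qed.

Let wE2 j x : (w j x)%:C%C =
  \sum_i \sum_k U j i * (U j k)^* * (xi_ k * (xi_ i)^-1)%g x.
Proof.
rewrite wE mulrC /E conj_sum mulr_suml; apply: eq_bigr => i _.
rewrite mulr_sumr; apply: eq_bigr => k _.
by rewrite conjM conjCK dual_mulE -dual_conj; ring.
Qed.

Let wc j : continuous (w j).
Proof.
have -> : w j = fun x => \sum_i \sum_k
   (complex.Re (U j i * (U j k)^*) * complex.Re ((xi_ k * (xi_ i)^-1)%g x) -
    complex.Im (U j i * (U j k)^*) * complex.Im ((xi_ k * (xi_ i)^-1)%g x)).
  apply/funext => x; have /= := congr1 (fun z : C => complex.Re z) (wE2 j x); move=> ->.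
  rewrite raddf_sum; apply: eq_bigr => i _; rewrite raddf_sum; apply: eq_bigr => k _ /=.
  by rewrite complexReM.
apply: continuous_sum => i; apply: continuous_sum => k.
by apply: contB; apply: contZ; [exact: dual_Re_continuous|exact: dual_Im_continuous].
Qed.

Let w0 j x : 0 <= w j x.
Proof.
have : 0 <= E j x * (E j x)^* by rewrite mul_conjC_ge0.
by rewrite lecE => /andP[].
Qed.

(** The quadratic form of the Toeplitz matrix of [tau] at the eigenvector [e j] of [sigma]. With
    [tau = 1] it gives the total mass of [w j], with [tau = sigma] the eigenvalue. *)
Let w_moment tau j : intble tau ->
  \sum_i \sum_k U j i * (U j k)^* * fourier_mx tau i k = (\int[mu]_x (tau x * w j x))%:C%C.
Proof.
move=> ti; rewrite -cintegral_real.
under [X in cintegral _ X]funext => x.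
  rewrite realM wE2 mulr_sumr; under eq_bigr do rewrite mulr_sumr.
  over.
have h i k : cintegrable mu (fun x => (tau x)%:C%C *
    (U j i * (U j k)^* * (xi_ k * (xi_ i)^-1)%g x)).
  under [X in cintegrable _ X]funext => x do rewrite mulrCA.
  by apply: (cintZ _ _).1; exact: cint_dual.
rewrite (cintegral_sum _ (fun i => (cintegral_sum _ (h i)).1)).2; apply: eq_bigr => i _.
rewrite (cintegral_sum _ (h i)).2; apply: eq_bigr => k _.
rewrite !mxE -(cintZ _ (cint_dual _ ti)).2; congr (cintegral _ _).
by apply/funext => x; rewrite mulrCA.
Qed.

Let lamE j : lam j = (\int[mu]_x (sigma x * w j x))%:C%C.
Proof.
rewrite -w_moment//.
have : (U *m A *m Ut) j j = diag_mx (spectral_diag A) j j.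
  congr (fun_of_matrix _ j j).
  rewrite [LHS](congr1 (fun X => U *m X *m Ut) AE) !mulmxA UUt mul1mx.
  by rewrite -[LHS]mulmxA UUt mulmx1.
rewrite !mxE eqxx mulr1n -/(lam j) => <-; rewrite exchange_big; apply: eq_bigr => k _ /=.
rewrite !mxE mulr_suml; apply: eq_bigr => i _; rewrite !mxE; ring.
Qed.

Lemma toeplitz_spectral : exists (w : 'I_n -> G -> R) (l : 'I_n -> R),
  [/\ forall j, continuous (w j), forall j x, 0 <= w j x,
      forall j, haar_int mu (w j) = 1 & forall x, \sum_j w j x = n%:R] /\
  [/\ forall j, l j = \int[mu]_x (sigma x * w j x),
      forall y, \sum_j l j * w j y = n%:R * convL1 mu (fejer Gam) sigma y &
      tr_log (toeplitz mu Gam sigma) = (\sum_j lne (l j)%:E)%E].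
Proof.
exists w, (fun j => \int[mu]_x (sigma x * w j x)); split; split=> //.
- move=> j; apply: (@complexI R).
  rewrite -[RHS](_ : \sum_i \sum_k U j i * (U j k)^* * fourier_mx (fun=> 1) i k = _).
    rewrite w_moment; last exact: finite_measure_integrable_cst.
    by congr (_%:C)%C; apply: eq_Rintegral => x _; rewrite mul1r.
  rewrite fourier_mx1 -[RHS](UUtE j).
  apply: eq_bigr => i _; rewrite (bigD1 i)//= big1 => [|k ki].
    by rewrite mxE eqxx addr0 mulr1.
  by rewrite mxE eq_sym (negbTE ki) mulr0.
- move=> x; apply: (@complexI R); rewrite real_sum.
  under eq_bigr do rewrite wE2.
  rewrite exchange_big /=; under eq_bigr do rewrite exchange_big /=.
  under eq_bigr => i _ do under eq_bigr => k _ do rewrite -mulr_suml UtUE.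
  rewrite real_nat -[n in RHS]card_ord -sumr_const; apply: eq_bigr => i _.
  rewrite (bigD1 i)//= big1 => [|k ki].
    by rewrite eqxx mul1r addr0 -[X in X = _]/((xi_ i * (xi_ i)^-1)%g x) mulgV.
  by rewrite eq_sym (negbTE ki) mul0r.
- move=> y; apply: (@complexI R); rewrite real_sum.
  under eq_bigr do rewrite realM -lamE wE2 mulr_sumr.
  rewrite exchange_big /=; under eq_bigr do under eq_bigr do rewrite mulr_sumr.
  under eq_bigr do rewrite exchange_big /=.
  (* The eigenbasis disappears from the sum. Writing the entries of [A] as integrals over [x] leaves
     [sigma x] times the double character sum at [y - x], which is [n] times the Fejer kernel. *)
  transitivity (\sum_i \sum_k A k i * (xi_ k * (xi_ i)^-1)%g y).
    apply: eq_bigr => i _; apply: eq_bigr => k _; rewrite Aik mulr_suml.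
    apply: eq_bigr => j _; rewrite -[(xi_ k * _)%g y]/(xi_ k y / xi_ i y).
    move: (_ / _) (U j i) (_^*) (lam j) => a b c d; ring.
  have h i k : cintegrable mu (fun x => (xi_ k * (xi_ i)^-1)%g y *
      ((sigma x)%:C%C * (xi_ i * (xi_ k)^-1)%g x)).
    by apply: (cintZ _ _).1; exact: cint_dual.
  transitivity (\sum_i \sum_k cintegral mu (fun x => (xi_ k * (xi_ i)^-1)%g y *
      ((sigma x)%:C%C * (xi_ i * (xi_ k)^-1)%g x))).
    apply: eq_bigr => i _; apply: eq_bigr => k _.
    by rewrite (cintZ _ (cint_dual _ sigma_int)).2 mxE mulrC.
  under eq_bigr do rewrite -(cintegral_sum _ (h _)).2.
  rewrite -(cintegral_sum _ (fun i => (cintegral_sum _ (h i)).1)).2.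
  rewrite /convL1 -RintegralZl//; last first.
    by apply: integrable_convL1_slice => //; exact: fejer_continuous.
  rewrite -cintegral_real; congr (cintegral _ _); apply/funext => x.
  rewrite mulrA realM -(opprB x y) fejer_opp -sum_dual_fejer// mulrC mulr_sumr (big_tnth _ _ Gam).
  apply: eq_bigr => i _; rewrite mulr_sumr (big_tnth _ _ Gam); apply: eq_bigr => k _.
  rewrite -/(xi_ i) -/(xi_ k) dualD dual_opp invgM invgK; ring.
- by rewrite (tr_log_eigenbasis e_basis Te); apply: eq_bigr => j _; rewrite lamE.
Qed.

End ToeplitzSpectral.

(** * Szego bounds *)

Section LogIntegral.
Context d (T : measurableType d) (R : realType) (P : probability T R).
Variable sigma : T -> R.
Hypothesis sigma_ge0 : forall x, 0 <= sigma x.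
Hypothesis sigma_int : P.-integrable setT (fun x => (sigma x)%:E).
Local Notation intble f := (P.-integrable setT (fun x : T => (f x)%:E)).

Lemma ln_le_sub1 (x : R) : 0 < x -> ln x <= x - 1.
Proof. by move=> x0; rewrite -[in ln x](subrKC 1 x) le_ln1Dx//; lra. Qed.

Lemma sigma_measurable : measurable_fun setT sigma.
Proof. exact/measurable_EFinP/(measurable_int P). Qed.

Lemma ln_shift_integrable e : 0 < e -> intble (fun x => ln (sigma x + e)).
Proof.
move=> e0; have mf : measurable_fun setT (fun x => ln (sigma x + e)).
  by apply: measurableT_comp => //; apply: measurable_funD => //; exact: sigma_measurable.
apply: (@le_integrable _ _ _ P setT measurableT _ (fun x => (sigma x + (`|ln e| + e))%:E)).
- exact/measurable_EFinP.
- move=> x _ /=; rewrite lee_fin [leRHS]ger0_norm; last by rewrite !addr_ge0 ?(ltW e0).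
  have s0 := sigma_ge0 x; have se : 0 < sigma x + e by rewrite ltr_wpDl.
  have h1 := ln_le_sub1 se.
  have h2 : ln e <= ln (sigma x + e) by rewrite ler_ln ?posrE// lerDr.
  have h3 := ler_norm (- ln e); rewrite normrN in h3.
  have h4 := normr_ge0 (ln e); rewrite ler_norml; apply/andP; split; lra.
- by apply: integrable_addR => //; exact: finite_measure_integrable_cst.
Qed.

Definition shift k : R := k.+1%:R^-1.

Lemma shift_gt0 k : 0 < shift k. Proof. by rewrite invr_gt0. Qed.

Lemma shift_le1 k : shift k <= 1.
Proof. by rewrite invf_le1// ler1n. Qed.

Lemma shift_le k m : (k <= m)%N -> shift m <= shift k.
Proof. by move=> km; rewrite lef_pV2 ?posrE// ler_nat. Qed.

Let Phi k := \int[P]_x ln (sigma x + shift k).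

Lemma ln_shift_nonincreasing k m : (k <= m)%N -> Phi m <= Phi k.
Proof.
move=> km; apply: le_RintegralT; try exact/ln_shift_integrable/shift_gt0.
by move=> x; rewrite ler_ln ?posrE ?ltr_wpDl ?shift_gt0// lerD2l shift_le.
Qed.

(** Nonnegative because [ln (sigma + shift k) <= sigma + shift k - 1] and [shift k <= 1]; increasing
    in [k]. *)
Let u k x := sigma x - ln (sigma x + shift k).

Let u_ge0 k x : 0 <= u k x.
Proof.
have se : 0 < sigma x + shift k by rewrite ltr_wpDl ?shift_gt0.
by have := ln_le_sub1 se; have := shift_le1 k; rewrite /u; lra.
Qed.

Let u_cvg x : ((u k x)%:E @[k --> \oo] --> (sigma x)%:E - lne (sigma x)%:E)%E.
Proof.
have [s0|s0] := ltP 0 (sigma x).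
  rewrite lne_EFin// -EFinB; apply/fine_cvgP; split; first exact: nearW.
  apply: cvgB; first exact: cvg_cst.
  have h : (fun k => sigma x + shift k) @ \oo --> sigma x.
    rewrite -[X in _ --> X]addr0; apply: cvgD; first exact: cvg_cst.
    exact: cvg_harmonic.
  exact: (cvg_comp _ _ h (continuous_ln s0)).
have {}s0 : sigma x = 0 by apply/le_anti; rewrite s0 sigma_ge0.
rewrite s0 le0_lneNy//= add0e; apply/cvgeyPge => A.
exists (Num.truncn (expR A)) => // k /= kA; rewrite lee_fin /u s0 sub0r add0r lnV ?posrE// opprK.
rewrite -[leLHS]expRK ler_ln ?posrE ?expR_gt0//; apply/ltW/(lt_le_trans (truncnS_gt _)).
by rewrite ler_nat.
Qed.

Let u_int k : intble (u k).
Proof. by apply: integrable_subR => //; exact/ln_shift_integrable/shift_gt0. Qed.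

Let PhiE k : (Phi k)%:E = (\int[P]_x (sigma x)%:E - \int[P]_x (u k x)%:E)%E.
Proof.
have -> : Phi k = \int[P]_x sigma x - \int[P]_x u k x.
  rewrite -(RintegralB measurableT sigma_int (u_int k)) /Phi; apply: eq_Rintegral => x _.
  rewrite /u; lra.
by rewrite EFinB /Rintegral !fineK//; exact: integrable_fin_num.
Qed.

(* Monotone convergence needs nonnegative functions, hence the detour through *)
(* [sigma - ln (sigma + shift k)].                                            *)
Lemma ln_shift_cvg : ((Phi k)%:E @[k --> \oo] --> \int[P]_x lne (sigma x)%:E)%E.
Proof.
pose ulim x := ((sigma x)%:E - lne (sigma x)%:E)%E.
have mu_ k : measurable_fun setT (EFin \o u k) by apply: (measurable_int P); exact: u_int.
have ulim0 x : (0 <= ulim x)%E.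
  by rewrite /ulim sube_ge0 ?ltW ?lne_sublinear// orbT.
have mulim : measurable_fun setT ulim.
  by apply: (emeasurable_fun_cvg _ _ mu_) => x _; exact: u_cvg.
have ucvg : (\int[P]_x (u k x)%:E @[k --> \oo] --> \int[P]_x ulim x)%E.
  rewrite (_ : (\int[P]_x ulim x)%E = (\int[P]_x limn (fun k => (u k x)%:E))%E); last first.
    by apply: eq_integral => x _; apply/esym/cvg_lim => //; exact: u_cvg.
  apply: (cvg_monotone_convergence measurableT (g' := fun k x => (u k x)%:E)) => //.
    by move=> k x _; rewrite lee_fin.
  move=> x _ k m km; rewrite lee_fin /u lerD2l lerN2.
  by rewrite ler_ln ?posrE ?ltr_wpDl ?shift_gt0// lerD2l shift_le.
have mln : measurable_fun setT (fun x => lne (sigma x)%:E).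
  rewrite (_ : (fun x => _) = (fun x => (sigma x)%:E - ulim x)%E); last first.
    apply/funext => x; rewrite /ulim.
    by case: (lne _) (lne_sublinear (isT : (sigma x)%:E \is a fin_num)) => //= r _;
      rewrite -EFinB subKr.
  by apply: emeasurable_funB => //; exact: (measurable_int P).
pose f x := lne (sigma x)%:E.
have fp0 x : (0 <= f^\+ x)%E by exact: funepos_ge0.
have fn0 x : (0 <= f^\- x)%E by exact: funeneg_ge0.
(* The identity [ulim = sigma - f] is integrated in additive form, with nonnegative terms only, as
   [ulim] and [f^\-] may both have integral [+oo]. *)
have eqf : (\int[P]_x ulim x + \int[P]_x f^\+ x = \int[P]_x (sigma x)%:E + \int[P]_x f^\- x)%E.
  have mfp : measurable_fun setT f^\+%E by exact: measurable_funepos.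
  have mfn : measurable_fun setT f^\-%E by exact: measurable_funeneg.
  have ms : measurable_fun setT (fun x => (sigma x)%:E) by exact: (measurable_int P).
  rewrite -ge0_integralD// -ge0_integralD//; last by move=> x _; rewrite lee_fin.
  apply: eq_integral => x _.
  have : (lne (sigma x)%:E < (sigma x)%:E)%E by exact: lne_sublinear.
  rewrite /ulim funeposE funenegE /f; case: (lne _) => [r||] //= _.
    rewrite -!EFin_max -!EFinD; congr _%:E.
    by have [r0|r0] := leP 0 r; [rewrite max_r|rewrite max_l]; lra.
  by rewrite maxNye maxye addey.
have fp_le : (\int[P]_x f^\+ x <= \int[P]_x (sigma x)%:E)%E.
  apply: ge0_le_integral => //.
  - exact: measurable_funepos.
  - exact: (measurable_int P).
  - move=> x _; rewrite funeposE ge_max lee_fin sigma_ge0 andbT.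
    by apply/ltW/lne_sublinear.
have sfin := integrable_fin_num measurableT sigma_int.
have fpfin : (\int[P]_x f^\+ x)%E \is a fin_num.
  rewrite ge0_fin_numE ?integral_ge0//; apply: le_lt_trans fp_le _.
  by rewrite -ge0_fin_numE ?integral_ge0// => x _; rewrite lee_fin.
have -> : (\int[P]_x lne (sigma x)%:E = \int[P]_x (sigma x)%:E - \int[P]_x ulim x)%E.
  rewrite integralE -/f; move: eqf.
  have : (0 <= \int[P]_x f^\- x)%E by exact: integral_ge0.
  have : (0 <= \int[P]_x ulim x)%E by exact: integral_ge0.
  case: (\int[P]_x f^\+ x)%E fpfin => // p _; case: (\int[P]_x (sigma x)%:E)%E sfin => // s _.
  case: (\int[P]_x ulim x)%E => [a||]; case: (\int[P]_x f^\- x)%E => [b||] //= _ _.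
  rewrite -!EFinD => -[e]; congr _%:E; lra.
under eq_fun do rewrite PhiE.
apply: cvgeB ucvg; last exact: cvg_cst.
by rewrite fin_num_adde_defr.
Qed.

End LogIntegral.

Lemma ln_le_tangent (R : realType) (a b : R) : 0 < a -> 0 < b -> ln a <= ln b + (a / b - 1).
Proof.
move=> a0 b0; have := ln_le_sub1 (divr_gt0 a0 b0); rewrite ln_div ?posrE//; lra.
Qed.

(** Removes the shift from the eigenvalues. If some [l j] is 0, its shifted logarithm drives the
    bound to [-oo], so [L] cannot be real; otherwise [ln (l j + shift k)] exceeds [ln (l j)] by at
    most [shift k / l j]. *)
Lemma le_mean_lne (R : realType) n (l : 'I_n -> R) (L : \bar R) : (0 < n)%N ->
  (forall j, 0 <= l j) ->
  (forall k, (L <= (n%:R^-1 * \sum_j ln (l j + shift R k))%:E)%E) ->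
  (L <= (n%:R^-1)%:E * \sum_j lne (l j)%:E)%E.
Proof.
move=> n0 l0 Lle; have nR : 0 < (n%:R : R) by rewrite ltr0n.
case: L Lle => [r||] Lle; [|by have := Lle 0%N|by rewrite leNye].
have {}Lle k : n%:R * r <= \sum_j ln (l j + shift R k).
  by rewrite -ler_pdivlMl// -lee_fin; exact: Lle.
have [[j0 lj0]|lpos] := pselect (exists j, l j = 0).
  exfalso; pose M := \sum_(j < n | j != j0) ln (l j + 1).
  have h k : n%:R * r <= ln (shift R k) + M.
    apply: le_trans (Lle k) _; rewrite (bigD1 j0)//= lj0 add0r lerD2l.
    apply: ler_sum => j _; rewrite ler_ln ?posrE ?ltr_wpDl ?shift_gt0//.
    by rewrite lerD2l shift_le1.
  have := h (Num.truncn (expR (M - n%:R * r))).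
  rewrite lnV ?posrE//; apply/negP; rewrite -ltNge.
  suff : M - n%:R * r < ln (Num.truncn (expR (M - n%:R * r))).+1%:R by lra.
  by rewrite -[ltLHS]expRK ltr_ln ?posrE ?expR_gt0// truncnS_gt.
have lj j : 0 < l j.
  by rewrite lt_neqAle l0 andbT eq_sym; apply/eqP => h; apply: lpos; exists j.
under eq_bigr do rewrite lne_EFin//.
rewrite sumEFin -EFinM lee_fin ler_pdivlMl//.
apply/ler_addgt0Pr => e e0; pose K := \sum_j (l j)^-1.
have K0 : 0 <= K by apply: sumr_ge0 => j _; rewrite invr_ge0.
pose k := Num.truncn (K / e).
apply: le_trans (Lle k) _; apply: (@le_trans _ _ (\sum_j (ln (l j) + shift R k * (l j)^-1))).
  apply: ler_sum => j _; have := ln_le_tangent (_ : 0 < l j + shift R k) (lj j).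
  rewrite ltr_wpDl ?shift_gt0// => /(_ isT) /le_trans; apply.
  by rewrite lerD2l mulrDl divff ?gt_eqF// addrAC subrr add0r.
rewrite big_split /= lerD2l -mulr_sumr -/K mulrC ler_pdivrMr// -ler_pdivrMl// mulrC.
exact/ltW/truncnS_gt.
Qed.

(** * Bounds for the mean logarithm of the eigenvalues *)

Section Szego.
Context (R : realType) (G : topologicalZmodType) (mu : probability (borel G) R).
Hypothesis Gcompact : compact [set: G].
Variable sigma : borel G -> R.
Hypothesis sigma_ge0 : forall x, 0 <= sigma x.
Local Notation intble f := (mu.-integrable setT (fun x : borel G => (f x)%:E)).
Hypothesis sigma_int : intble sigma.
Variables (n : nat) (w : 'I_n -> G -> R) (l : 'I_n -> R).
Hypothesis n0 : (0 < n)%N.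
Hypothesis w_cont : forall j, continuous (w j).
Hypothesis w_ge0 : forall j x, 0 <= w j x.
Hypothesis w_int1 : forall j, haar_int mu (w j) = 1.
Hypothesis w_sum : forall x, \sum_j w j x = n%:R.
Hypothesis lE : forall j, l j = \int[mu]_x (sigma x * w j x).
Local Notation Phi e := (\int[mu]_x ln (sigma x + e)).

Let w_mul_int (f : borel G -> R) j : intble f -> intble (fun x => f x * w j x).
Proof.
move=> fi; have [M M0 wM] := continuous_bounded Gcompact (@w_cont j).
under eq_fun do rewrite mulrC.
by apply: integrable_bounded_mul wM fi; exact: continuous_borel_measurable.
Qed.

Let l_ge0 j : 0 <= l j.
Proof. by rewrite lE; apply: Rintegral_ge0 => x _; rewrite mulr_ge0. Qed.

Let w_mean (f : borel G -> R) : intble f ->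
  \sum_j \int[mu]_x (f x * w j x) = n%:R * \int[mu]_x f x.
Proof.
move=> fi; rewrite -Rintegral_sum; last by move=> j; exact: w_mul_int.
rewrite -RintegralZl//; apply: eq_Rintegral => x _.
by rewrite -mulr_sumr w_sum mulrC.
Qed.

(* Jensen's inequality for the probability densities [w j], through the tangent at [l j + e]. *)
Lemma szego_lower e : 0 < e -> Phi e <= n%:R^-1 * \sum_j ln (l j + e).
Proof.
move=> e0; have li := ln_shift_integrable sigma_ge0 sigma_int e0.
rewrite ler_pdivlMl ?ltr0n// -w_mean//; apply: ler_sum => j _.
have le0 : 0 < l j + e by rewrite ltr_wpDl.
pose c := (l j + e)^-1.
have i1 : intble (w j) by exact: continuous_integrable.
have i2 : intble (fun x => sigma x * w j x) by exact: w_mul_int.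
have i3 := integrable_mulR (ln (l j + e) - 1 + e * c) i1.
have i4 := integrable_mulR c i2.
apply: (@le_trans _ _ (\int[mu]_x ((ln (l j + e) - 1 + e * c) * w j x + c * (sigma x * w j x)))).
  apply: le_RintegralT; first exact: w_mul_int.
    exact: integrable_addR.
  move=> x; have se : 0 < sigma x + e by rewrite ltr_wpDl.
  have := ler_wpM2r (w_ge0 j x) (ln_le_tangent se le0); rewrite -/c.
  by move=> /le_trans; apply; rewrite le_eqVlt; apply/orP; left; apply/eqP; ring.
rewrite RintegralD// !RintegralZl// -lE.
rewrite -[X in _ * X + _]/(haar_int mu (w j)) w_int1 mulr1 le_eqVlt.
by apply/orP; left; apply/eqP; rewrite /c; field; exact: lt0r_neq0.
Qed.

Variable tau : borel G -> R.
Hypothesis tau_int : intble tau.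
Hypothesis tauE : forall x, \sum_j l j * w j x = n%:R * tau x.

Lemma szego_upper e : 0 < e -> (forall j, 0 < l j) ->
  n%:R^-1 * \sum_j ln (l j) <= Phi e + e^-1 * \int[mu]_x `|tau x - sigma x|.
Proof.
move=> e0 lpos; have li := ln_shift_integrable sigma_ge0 sigma_int e0.
have nR : 0 < (n%:R : R) by rewrite ltr0n.
have di := integrable_normR (integrable_subR tau_int sigma_int).
have i2 := integrable_mulR e^-1 di.
have i1 j : intble (w j) by exact: continuous_integrable.
rewrite -RintegralZl// -RintegralD// ler_pdivrMl// -RintegralZl//; last exact: integrable_addR.
have -> : \sum_j ln (l j) = \int[mu]_x \sum_j (ln (l j) * w j x).
  rewrite Rintegral_sum; last by move=> j; exact: integrable_mulR.
  apply: eq_bigr => j _; rewrite RintegralZl//; last exact: i1.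
  by rewrite -[X in _ * X]/(haar_int mu (w j)) w_int1 mulr1.
apply: le_RintegralT.
- by apply: integrable_sumR => j; exact: integrable_mulR.
- by apply: integrable_mulR; exact: integrable_addR.
move=> x; have se : 0 < sigma x + e by rewrite ltr_wpDl.
have h j : ln (l j) * w j x <= (ln (sigma x + e) - 1) * w j x + (sigma x + e)^-1 * (l j * w j x).
  have := ler_wpM2r (w_ge0 j x) (ln_le_tangent (lpos j) se).
  by move=> /le_trans; apply; rewrite le_eqVlt; apply/orP; left; apply/eqP; ring.
apply: le_trans (ler_sum _ (fun j _ => h j)) _.
rewrite big_split /= -!mulr_sumr w_sum tauE mulrCA (mulrC (_ - 1)) -mulrDr ler_pM2l//.
rewrite -addrA lerD2l.
(* After summation over [j] the tangent inequality leaves this error term; dropping [- e] and using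
   [sigma x + e >= e] bounds it by [e^-1 * |tau x - sigma x|]. *)
have -> : -1 + (sigma x + e)^-1 * tau x = (sigma x + e)^-1 * (tau x - sigma x - e).
  by field; exact: lt0r_neq0.
apply: (@le_trans _ _ ((sigma x + e)^-1 * `|tau x - sigma x|)).
  rewrite ler_wpM2l ?invr_ge0 ?ltW//; have := ler_norm (tau x - sigma x); lra.
by rewrite ler_wpM2r// lef_pV2 ?posrE// lerDr.
Qed.

End Szego.

Lemma Rintegral_ae d (T : measurableType d) (R : realType) (P : {measure set T -> \bar R})
    (f g : T -> R) :
  P.-integrable setT (fun x => (f x)%:E) -> P.-integrable setT (fun x => (g x)%:E) ->
  (\forall x \ae P, f x = g x) -> \int[P]_x f x = \int[P]_x g x.
Proof.
move=> fi gi fg; congr fine; apply: ae_eq_integral => //.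
- exact: (measurable_int P).
- exact: (measurable_int P).
- by apply: filterS fg => x /= -> _.
Qed.

(** Testing the upper bound against real [c] treats a real [L] and [L = -oo] alike. *)
Lemma cvge_of_bounds (R : realType) (a : nat -> \bar R) (L : \bar R) : (L < +oo)%E ->
  (forall N, (L <= a N)%E) ->
  (forall c : R, (L < c%:E)%E -> \forall N \near \oo, (a N <= c%:E)%E) ->
  a @ \oo --> L.
Proof.
case: L => [r||] // _ La aL; last first.
  by apply/cvgeNyPle => A; apply: aL; rewrite ltNyr.
have afin : \forall N \near \oo, a N \is a fin_num.
  have := aL (r + 1); rewrite lte_fin ltrDl => /(_ ltr01).
  apply: filterS => N aN; rewrite fin_numElt (lt_le_trans _ (La N)) ?ltNyr//.
  exact: le_lt_trans aN (ltry _).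
apply/fine_cvgP; split=> //; apply/cvgrPdist_le => e e0.
have := aL (r + e); rewrite lte_fin ltrDl => /(_ e0) h.
apply: filterS2 afin h => N /= aN; have := La N; rewrite -(fineK aN) !lee_fin => h1 h2.
rewrite ler_norml; lra.
Qed.

Local Open Scope classical_set_scope.
Local Open Scope fset_scope.
Local Open Scope ring_scope.

Theorem corollary4p6 (R : realType) (G : topologicalZmodType)
    (mu : probability (borel G) R) (Gam : nat -> {fset dual R G})
    (sigma : G -> R) :
  compact [set: G] -> metrizable R G ->
  haar_invariant mu ->
  (forall N, Gam N != fset0) ->
  (forall eta : dual R G,
    let etaGam N := [fset (eta * xi)%g | xi in Gam N] in
    (fun N => #|` (etaGam N `\` Gam N) `|` (Gam N `\` etaGam N)|%:R
              / #|` Gam N|%:R : R) @ \oo --> (0 : R)) ->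
  mu.-integrable setT (EFin \o sigma) ->
  (\forall x \ae mu, 0 <= sigma x) ->
  (fun N => ((#|` Gam N|%:R^-1)%:E * tr_log (toeplitz mu (Gam N) sigma))%E)
    @ \oo --> (\int[mu]_x lne (sigma x)%:E)%E.
Proof.
move=> Gc Gm inv Gam0 folner si s0.
(* [s] is nonnegative everywhere and agrees with [sigma] almost everywhere. The logarithms agree at
   every point, since [lne] is [-oo] at nonpositive arguments. *)
pose s : borel G -> R := fun x => Num.max 0 (sigma x).
have s_ge0 x : 0 <= s x by rewrite le_max lexx.
have s_int : mu.-integrable setT (fun x => (s x)%:E).
  apply: (@le_integrable _ _ _ mu setT measurableT _ (EFin \o sigma)) => //.
    apply/measurable_EFinP; apply: measurable_maxr => //.
    by apply/measurable_EFinP; exact: (measurable_int mu si).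
  move=> x _ /=; rewrite lee_fin ger0_norm// /s ge_max normr_ge0 ler_norm.
  by [].
have s_ae : \forall x \ae mu, sigma x = s x.
  by apply: (@filterS _ _ (ae_filter_ringOfSetsType mu)) s0 => x sx; rewrite /s max_r.
rewrite (_ : (\int[mu]_x _)%E = (\int[mu]_x lne (s x)%:E)%E); last first.
  apply: eq_integral => x _; rewrite /s; have [//|sx] := leP 0 (sigma x).
  by rewrite !le0_lneNy// lee_fin ltW.
have Phi_cvg := ln_shift_cvg s_ge0 s_int.
set L := (\int[mu]_x lne (s x)%:E)%E in Phi_cvg *.
pose Phi k := \int[mu]_x ln (s x + shift R k).
have L_Phi k : (L <= (Phi k)%:E)%E.
  apply: (cvge_to_le Phi_cvg); exists k => // m km /=.
  by rewrite lee_fin; exact: ln_shift_nonincreasing.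
have spec N : exists (w : 'I_(size (enum_fset (Gam N))) -> G -> R) l,
  [/\ forall j, continuous (w j), forall j x, 0 <= w j x,
      forall j, haar_int mu (w j) = 1 & forall x, \sum_j w j x = #|` Gam N|%:R] /\
  [/\ forall j, l j = \int[mu]_x (s x * w j x),
      forall y, \sum_j l j * w j y = #|` Gam N|%:R * convL1 mu (fejer (Gam N)) s y &
      tr_log (toeplitz mu (Gam N) sigma) = (\sum_j lne (l j)%:E)%E].
  have [w [l [[w1 w2 w3 w4] [l1 l2 l3]]]] := toeplitz_spectral Gc inv (Gam0 N) si.
  exists w, l; split; split => //.
    move=> j; rewrite l1; have [M M0 wM] := continuous_bounded Gc (@w1 j).
    have wi (f : borel G -> R) : mu.-integrable setT (fun x => (f x)%:E) ->
        mu.-integrable setT (fun x => (f x * w j x)%:E).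
      move=> fi; under eq_fun do rewrite mulrC.
      by apply: integrable_bounded_mul wM fi; exact: continuous_borel_measurable.
    apply: Rintegral_ae; [exact: wi|exact: wi|].
    by apply: (@filterS _ _ (ae_filter_ringOfSetsType mu)) s_ae => x /= ->.
  move=> y; rewrite l2; congr (_ * _); apply: Rintegral_ae.
  - by apply: integrable_convL1_slice => //; exact: fejer_continuous.
  - by apply: integrable_convL1_slice => //; exact: fejer_continuous.
  - by apply: (@filterS _ _ (ae_filter_ringOfSetsType mu)) s_ae => x /= ->.
have n0 N : (0 < size (enum_fset (Gam N)))%N by rewrite cardfs_gt0.
apply: cvge_of_bounds.
- by apply: le_lt_trans (L_Phi 0%N) _; rewrite ltry.
- move=> N; have [w [l [[w1 w2 w3 w4] [l1 l2 ->]]]] := spec N.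
  apply: le_mean_lne => // [j|k].
    by rewrite l1; apply: Rintegral_ge0 => x _; rewrite mulr_ge0.
  apply: le_trans (L_Phi k) _; rewrite lee_fin.
  exact: (szego_lower Gc s_ge0 s_int (n0 N) w1 w2 w3 w4 l1 (shift_gt0 R k)).
move=> c Lc; have [k Phik] : exists k, Phi k < c.
  apply: contrapT => /forallNP h; move: Lc; apply/negP; rewrite -leNgt.
  apply: (cvge_to_ge Phi_cvg); apply: nearW => k.
  by rewrite lee_fin leNgt; apply/negP; exact: h.
(* [szego_upper] divides the L^1 error by [shift R k]; this tolerance makes the quotient at most
   [c - Phi k]. *)
have d0 : 0 < (c - Phi k) * shift R k by rewrite mulr_gt0 ?subr_gt0 ?shift_gt0.
apply: filterS (fejer_L1 Gc Gm inv Gam0 folner s_int d0) => N hN.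
have [w [l [[w1 w2 w3 w4] [l1 l2 ->]]]] := spec N.
have l0 j : 0 <= l j by rewrite l1; apply: Rintegral_ge0 => x _; rewrite mulr_ge0.
(* A zero eigenvalue makes the left side [-oo]; otherwise all logarithms are real and [szego_upper]
   applies. *)
have [[j lj]|lpos] := pselect (exists j, l j = 0).
  rewrite (_ : (\sum_j _)%E = -oo%E).
    by rewrite gt0_muleNy ?leNye// lte_fin invr_gt0 ltr0n.
  by apply/esum_eqNyP; exists j; rewrite lj le0_lneNy ?mem_index_enum.
have lj j : 0 < l j.
  by rewrite lt_neqAle l0 andbT eq_sym; apply/eqP => h; apply: lpos; exists j.
under eq_bigr do rewrite lne_EFin//.
rewrite sumEFin -EFinM lee_fin.
have ti : mu.-integrable setT (fun x => (convL1 mu (fejer (Gam N)) s x)%:E).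
  by apply: integrable_convL1 => //; exact: fejer_continuous.
have h := szego_upper Gc s_ge0 s_int (n0 N) w1 w2 w3 w4 ti l2 (shift_gt0 R k) lj.
apply: le_trans h _.
by rewrite -lerBrDl mulrC ler_pdivrMr ?shift_gt0.
Qed.
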